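(* Let $n\ge2$, $1\le m<n$, let $\Sigma_0,\Sigma_1\in\mathrm{Sym}^+(n)$, let $\varepsilon>0$, and let $(Y_t)_{t\in[0,1]}$ be a continuously differentiable curve in $\mathbb{R}^{n\times m}$ with $Y_t$ of full column rank for all $t$. Fix $N_0$ and define $M_t$, $N_t$ as in the context. If there exists at least one admissible pair for Problem 2$'$, then Problem 2$'$ has an absolute (global) minimizer $(K^\star_t,\Phi^\star_t)_{t\in[0,1]}$ among all admissible pairs.
   Context: $\mathrm{Sym}^+(n)$ denotes the set of real symmetric positive-definite $n\times n$ matrices and $\mathrm{GL}(n)$ the group of real invertible $n\times n$ matrices. For a pair of curves $(K_t,\Phi_t)_{t\in[0,1]}$ and $\Sigma_0\in\mathrm{Sym}^+(n)$, define $J_{\rm KE}=\frac12\int_0^1\mathrm{tr}(K_t\Phi_t\Sigma_0\Phi_t^\top K_t^\top)\,dt$ and $J_{\rm A}=\frac12\int_0^1\mathrm{tr}(K_tK_t^\top)\,dt$. Fix $N_0\in\mathbb{R}^{(n-m)\times n}$ with $N_0Y_0=0$ and $\mathrm{rank}([Y_0,\,N_0^\top])=n$; let $M_t=\dot Y_t(Y_t^\top Y_t)^{-1}Y_t^\top$ and let $(N_t)$ solve $\dot N_t=-N_tM_t$ with initial value $N_0$. Problem 2$'$: minimize $J_{\rm KE}+\varepsilon J_{\rm A}$ over pairs $(K_t,\Phi_t)_{t\in[0,1]}$ with $(K_t)$ square integrable and $(\Phi_t)$ absolutely continuous with values in $\mathrm{GL}(n)$, subject to: $\Phi_0=I$ and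 $\dot\Phi_t=K_t\Phi_t$ wherever $\dot\Phi_t$ exists; $\Phi_1\Sigma_0\Phi_1^\top=\Sigma_1$; $Y_1=\Phi_1Y_0$; and $K_t=M_t+R_tN_t$ for almost all $t$ for some square-integrable curve $(R_t)$ in $\mathbb{R}^{n\times(n-m)}$. An admissible pair for Problem 2$'$ is one satisfying all these constraints with finite cost. *)

(* Defs.v *)
From HB Require Import structures.
From mathcomp Require Import all_boot all_order all_algebra.
From mathcomp Require Import all_classical all_reals all_analysis.
Set Implicit Arguments. Unset Strict Implicit. Unset Printing Implicit Defensive.
Import Order.TTheory GRing.Theory Num.Theory.
Import numFieldNormedType.Exports.
Local Open Scope classical_set_scope.
Local Open Scope ring_scope.

Definition I01 {R : realType} : set R := `[0%R, 1%R]%classic.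

Definition SymPos {R : realType} (n : nat) (S : 'M[R]_n) : Prop :=
  S^T = S /\ forall v : 'cV[R]_n, v != 0 -> 0 < (v^T *m S *m v) 0 0.

Definition deriv_on01 {R : realType} (f fd : R -> R) : Prop :=
  forall t : R, 0 <= t <= 1 ->
    (fun s => (f s - f t) / (s - t)) @ within [set s : R | 0 <= s <= 1 /\ s != t] (nbhs t)
      --> fd t.

Definition mx_deriv_on01 {R : realType} (p q : nat) (F Fd : R -> 'M[R]_(p, q)) : Prop :=
  forall i j, deriv_on01 (fun t => F t i j) (fun t => Fd t i j).

Definition mx_C1_on01 {R : realType} (p q : nat) (F Fd : R -> 'M[R]_(p, q)) : Prop :=
  mx_deriv_on01 F Fd /\
  forall i j, {within (@I01 R), continuous (fun t => Fd t i j)}.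

Definition abs_cont_on {R : realType} (a b : R) (f : R -> R) : Prop :=
  forall e : R, 0 < e -> exists2 d : R, 0 < d &
    forall s : seq (R * R),
      all (fun x => (a <= x.1) && (x.1 <= x.2) && (x.2 <= b)) s ->
      pairwise (fun x y => (x.2 <= y.1) || (y.2 <= x.1)) s ->
      \sum_(x <- s) (x.2 - x.1) < d ->
      \sum_(x <- s) `|f x.2 - f x.1| < e.

Definition mx_abs_cont_on01 {R : realType} (p q : nat) (F : R -> 'M[R]_(p, q)) : Prop :=
  forall i j, abs_cont_on 0 1 (fun t => F t i j).

Definition mx_sq_integrable01 {R : realType} (p q : nat) (F : R -> 'M[R]_(p, q)) : Prop :=
  forall i j,
    measurable_fun (@I01 R) (fun t => F t i j) /\
    (@lebesgue_measure R).-integrable (@I01 R) (fun t => ((F t i j) ^+ 2)%:E).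

Definition Mcurve {R : realType} (n m : nat) (Y Yd : R -> 'M[R]_(n, m)) (t : R) : 'M[R]_n :=
  Yd t *m invmx ((Y t)^T *m Y t) *m (Y t)^T.

Definition J_KE {R : realType} (n : nat) (S0 : 'M[R]_n) (K Phi : R -> 'M[R]_n) : \bar R :=
  ((2%:R)^-1)%:E *
  (\int[@lebesgue_measure R]_(t in (@I01 R))
     (\tr (K t *m Phi t *m S0 *m (Phi t)^T *m (K t)^T))%:E)%E.

Definition J_A {R : realType} (n : nat) (K : R -> 'M[R]_n) : \bar R :=
  ((2%:R)^-1)%:E *
  (\int[@lebesgue_measure R]_(t in (@I01 R)) (\tr (K t *m (K t)^T))%:E)%E.

Definition cost2' {R : realType} (n : nat) (eps : R) (S0 : 'M[R]_n) (K Phi : R -> 'M[R]_n)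
  : \bar R := (J_KE S0 K Phi + eps%:E * J_A K)%E.

Definition admissible2' {R : realType} (n m : nat) (eps : R) (S0 S1 : 'M[R]_n)
  (Y Yd : R -> 'M[R]_(n, m)) (N : R -> 'M[R]_(n - m, n))
  (K Phi : R -> 'M[R]_n) : Prop :=
  mx_sq_integrable01 K /\
      mx_abs_cont_on01 Phi /\
      (forall t : R, 0 <= t <= 1 -> Phi t \in unitmx) /\
      Phi 0 = 1%:M /\
      (forall t : R, 0 < t < 1 ->
         (forall i j, derivable (fun s => Phi s i j) t 1) ->
         forall i j, derive1 (fun s => Phi s i j) t = (K t *m Phi t) i j) /\
      Phi 1 *m S0 *m (Phi 1)^T = S1 /\
      Y 1 = Phi 1 *m Y 0 /\
      (exists Rc : R -> 'M[R]_(n, n - m),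
         mx_sq_integrable01 Rc /\
         {ae @lebesgue_measure R, forall t, (@I01 R) t ->
             K t = Mcurve Y Yd t + Rc t *m N t}) /\
  (cost2' eps S0 K Phi < +oo)%E.

(* Main.v *)
(* Direct method.  An absolutely continuous curve is the integral of its derivative (total
   variation, Lebesgue-Stieltjes measures, Radon-Nikodym), so an admissible pair satisfies
   Phi_t - Phi_s = \int_s^t K Phi.  A bound on \int |K|^2 then bounds Phi and Phi^-1 and makes
   Phi uniformly absolutely continuous, hence the pointwise limit of a minimizing sequence along
   an ultrafilter is absolutely continuous and invertible and inherits the end point constraint
   and Phi_t Y_0 = Y_t; the latter is equivalent to K = M + R N because the rows of N_t span the
   annihilator of Y_t.  For fixed P the cost density is a convex quadratic form W_P in V = Phi'.
   On a uniform grid, freezing P at the left node of each cell costs a factor 1 + o(1), uniformly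
   along the sequence, and Jensen's inequality bounds a finite sum of difference quotients of Phi
   by the cost.  These finite sums pass to the limit; refining the grid, Fatou's lemma bounds the
   cost of the limit. *)
Require Import Defs.
From HB Require Import structures.
From mathcomp Require Import all_boot all_order all_algebra.
From mathcomp Require Import all_classical all_reals all_analysis.
From mathcomp Require Import measurable_realfun ring lra.
Set Implicit Arguments. Unset Strict Implicit. Unset Printing Implicit Defensive.
Import Order.TTheory GRing.Theory Num.Theory.
Import numFieldNormedType.Exports.
Local Open Scope classical_set_scope.
Local Open Scope ring_scope.

(** * Absolutely continuous functions on the unit interval *)

(** The kinetic term controls only the product $K\Phi$; it is $\varepsilon J_{\rm A}$ that controls
    $K$ itself, with constant $1/\varepsilon$, and hence keeps the flow away from singular matrices.
    The cost density is convex in the derivative for fixed $\Phi$ but not jointly in both variables,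
    and this forces the freezing of $\Phi$. The error of freezing has to be relative, since only the
    integral of the density is bounded; a uniform bound on $\Phi^{-1}$ makes it so. The generators
    $K$ of a minimizing sequence are not passed to the limit. Only the matrices $\Phi_t$ at single
    times converge, and the optimal generator is read off afterwards as derivative times inverse;
    its cost is reached through sums that see finitely many times. Admissibility ties $K$ to $\Phi$
    only at points of differentiability, whereas every estimate needs increments of $\Phi$ as
    integrals; the measure theory below bridges this gap. *)

Definition itv_family {R : realType} (a b : R) (s : seq (R * R)) : bool :=
  all (fun x => (a <= x.1) && (x.1 <= x.2) && (x.2 <= b)) s &&
  pairwise (fun x y => (x.2 <= y.1) || (y.2 <= x.1)) s.

(** Left-open intervals match both Stieltjes measures and grid cells, so increments add up without
    boundary terms. Values of [f] and [g] outside the unit interval are left free. *)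
Definition prim {R : realType} (f g : R -> R) : Prop :=
  (@lebesgue_measure R).-integrable (@I01 R) (EFin \o g) /\
  forall s t, 0 <= s -> s <= t -> t <= 1 ->
    f t - f s = \int[@lebesgue_measure R]_(x in `]s, t]) g x.

(** * Total variation of absolutely continuous functions *)

Section total_variation_abs_cont.
Variable R : realType.
Implicit Types (a b : R) (f : R -> R) (s : seq (R * R)) (l : seq R).

Lemma variation_pairmap a b f l :
  variation a b f l = \sum_(x <- pairmap pair a l) `|f x.2 - f x.1|.
Proof.
rewrite /variation (big_nth (a, a)) size_pairmap !big_mkord.
by apply: eq_bigr => i _; rewrite (nth_pairmap b)//=.
Qed.

Lemma sum_pairmap a l : \sum_(x <- pairmap pair a l) (x.2 - x.1) = last a l - a.
Proof.
elim: l a => [|c l IH] a /=; first by rewrite big_nil subrr.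
by rewrite big_cons IH /= addrC addrA subrK.
Qed.

Lemma path_le_last a l : path <%O a l -> a <= last a l.
Proof.
elim: l a => [|c l IH] a //= /andP[ac /IH]; exact/le_trans/ltW.
Qed.

Lemma itv_family_pairmap a l : path <%O a l ->
  itv_family a (last a l) (pairmap pair a l).
Proof.
rewrite /itv_family; elim: l a => [|c l IH] a //= /andP[ac pl].
have /andP[H1 H2] := IH _ pl.
rewrite lexx (ltW ac) path_le_last//= H2 andbT; apply/andP; split.
  apply: sub_all H1 => x /andP[/andP[h1 h2] h3].
  by rewrite h2 h3 !andbT (le_trans (ltW ac)).
by apply: sub_all H1 => x /andP[/andP[h1 h2] h3] /=; rewrite h1.
Qed.

Lemma itv_family_refine (x : R * R) s r l : path <%O x.1 l -> last x.1 l = x.2 ->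
  itv_family 0 1 ((x :: s) ++ r) ->
  itv_family 0 1 (s ++ (pairmap pair x.1 l ++ r)).
Proof.
move=> pl ll; rewrite /itv_family /= !all_cat !pairwise_cat !allrel_catr.
move=> /andP[/andP[/andP[/andP[x0 x12] x1] /andP[H1 H2]] /andP[/andP[H3 H3'] /and3P[H4 H5 H6]]].
have /andP[P1 P2] := itv_family_pairmap pl.
move: P1; rewrite ll => P1; rewrite H1 H2 H4 H5 H6 P2 /= !andbT.
apply/and3P; split.
- apply: sub_all P1 => y /andP[/andP[h1 h2] h3].
  by rewrite (le_trans x0 h1) h2 (le_trans h3 x1).
- apply/allrelP => y z ys /(allP P1) /andP[/andP[h1 h2] h3].
  have /orP[h|h] := allP H3 _ ys.
    by rewrite (le_trans h3 h) orbT.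
  by rewrite (le_trans h h1).
- apply/allrelP => z y /(allP P1) /andP[/andP[h1 h2] h3] yr.
  have /orP[h|h] := allP H3' _ yr.
    by rewrite (le_trans h3 h).
  by rewrite (le_trans h h1) orbT.
Qed.

(** Intervals in [s] carry a total variation, those in [r] a plain increment. A variation is a
    supremum over partitions, and the pieces of a partition can move into [r] without changing the
    total length; the induction thus removes one supremum at a time. *)
Lemma sum_total_variation_le f (e d : R) :
  (forall s, itv_family 0 1 s -> \sum_(x <- s) (x.2 - x.1) < d ->
    \sum_(x <- s) `|f x.2 - f x.1| < e) ->
  forall s r, itv_family 0 1 (s ++ r) -> \sum_(x <- s ++ r) (x.2 - x.1) < d ->
  (\sum_(x <- s) total_variation x.1 x.2 f +
   (\sum_(x <- r) `|f x.2 - f x.1|)%:E <= e%:E)%E.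
Proof.
move=> H; elim=> [|x s IH] r fam lt_d.
  by rewrite big_nil add0e lee_fin ltW// H.
have /andP[/= /andP[/andP[/andP[x0 x12] x1] al] /andP[_ pw]] := fam.
have fam' : itv_family 0 1 (s ++ r) by rewrite /itv_family al pw.
have lt_d' : \sum_(x <- s ++ r) (x.2 - x.1) < d.
  by apply: le_lt_trans lt_d; rewrite /= big_cons lerDr subr_ge0.
have Zle := IH _ fam' lt_d'.
set Z := (X in (X <= _)%E) in Zle.
have Z0 : (0 <= Z)%E.
  rewrite adde_ge0//; last by rewrite lee_fin sumr_ge0.
  rewrite big_seq sume_ge0// => y ys; apply: total_variation_ge0.
  by move/allP: al => /(_ y); rewrite mem_cat ys => /(_ isT) /andP[/andP[]].
(* Finiteness of the remaining terms allows subtracting them, so that the supremum for [x] stands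
   alone. *)
have Zfin : Z \is a fin_num by rewrite ge0_fin_numE// (le_lt_trans Zle)// ltry.
rewrite big_cons -addeA -/Z -leeBrDr//.
apply: ge_ereal_sup => _ /= [_ [l [pl /eqP ll] <-] <-].
rewrite leeBrDr// /Z variation_pairmap addeCA -EFinD -big_cat /=.
apply: IH; first exact: itv_family_refine.
move: lt_d; rewrite !big_cat/= big_cons sum_pairmap ll.
by rewrite [in X in X -> _]addrAC addrC -addrA addrA addrC.
Qed.

Lemma abs_cont_sum_total_variation f : abs_cont_on 0 1 f ->
  forall e : R, 0 < e -> exists2 d : R, 0 < d &
    forall s, itv_family 0 1 s -> \sum_(x <- s) (x.2 - x.1) < d ->
    (\sum_(x <- s) total_variation x.1 x.2 f <= e%:E)%E.
Proof.
move=> ac e e0; have [d d0 H] := ac _ e0; exists d => // s fam lt_d.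
have := @sum_total_variation_le f e d _ s [::]; rewrite cats0 big_nil adde0.
by apply=> // s' /andP[]; exact: H.
Qed.

(** With tolerance 1, every interval shorter than some [d] has variation at most 1, and finitely
    many grid cells of such length fill the unit interval. *)
Lemma abs_cont_total_variation_fin f : abs_cont_on 0 1 f ->
  total_variation 0 1 f \is a fin_num.
Proof.
move=> ac; have [d d0 H] := abs_cont_sum_total_variation ac ltr01.
have [k kd] : exists k : nat, k.+1%:R^-1 < d.
  by have [k _ /(_ k (leqnn k))] := near_infty_natSinv_lt (PosNum d0); exists k.
suff Hi i : (i <= k.+1)%N -> (total_variation 0 (i%:R / k.+1%:R) f < +oo)%E.
  have := Hi _ (leqnn _); rewrite divff ?pnatr_eq0// => h.
  by rewrite ge0_fin_numE// total_variation_ge0.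
elim: i => [|i IH] ik; first by rewrite mul0r total_variationxx.
have i0 : 0 <= i%:R / k.+1%:R :> R by rewrite divr_ge0.
have ii : i%:R / k.+1%:R <= i.+1%:R / k.+1%:R :> R.
  by rewrite ler_pM2r ?invr_gt0// ler_nat.
rewrite (total_variationD _ i0 ii); apply: lte_add_pinfty; first exact/IH/ltnW.
apply: (@le_lt_trans _ _ 1%:E); last exact: ltry.
have := H [:: (i%:R / k.+1%:R, i.+1%:R / k.+1%:R)]; rewrite !big_seq1/=; apply.
  by rewrite /itv_family/= i0 ii /= !andbT ler_pdivrMr// mul1r ler_nat.
by rewrite -mulrBl -natrB// subSnn mul1r.
Qed.

(** The variation from 0 up to [t] serves as [V]. Since it dominates the increments of [f], both [V]
    and [V \- f] are nondecreasing: the Jordan decomposition within absolutely continuous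
    functions. *)
Lemma abs_cont_variation f : abs_cont_on 0 1 f ->
  exists2 V : R -> R, abs_cont_on 0 1 V &
    (forall s t : R, 0 <= s -> s <= t -> t <= 1 -> `|f t - f s| <= V t - V s).
Proof.
move=> ac; have fin01 := abs_cont_total_variation_fin ac.
have fin (s t : R) : 0 <= s -> s <= t -> t <= 1 -> total_variation s t f \is a fin_num.
  move=> s0 st t1; rewrite ge0_fin_numE ?total_variation_ge0//.
  apply: le_lt_trans (_ : total_variation 0 1 f < +oo)%E; last first.
    by move: fin01; rewrite ge0_fin_numE ?total_variation_ge0.
  rewrite (total_variationD f s0 (le_trans st t1)) (total_variationD f st t1).
  rewrite addeCA leeDl// adde_ge0// total_variation_ge0//.
pose V t := fine (total_variation 0 t f).
have VB (s t : R) : 0 <= s -> s <= t -> t <= 1 ->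
    (V t - V s)%:E = total_variation s t f.
  move=> s0 st t1; rewrite /V (total_variationD f s0 st).
  rewrite fineD ?fin// ?(le_trans st)// addrAC subrr add0r fineK// fin//.
have Vle (s t : R) : 0 <= s -> s <= t -> t <= 1 -> `|f t - f s| <= V t - V s.
  by move=> s0 st t1; rewrite -lee_fin VB// total_variation_ge.
exists V => // e e0.
have e20 : 0 < e / 2 by rewrite divr_gt0.
have [d d0 H] := abs_cont_sum_total_variation ac e20.
exists d => // s al pw lt_d.
apply: (@le_lt_trans _ _ (e / 2)); last by rewrite ltr_pdivrMr// ltr_pMr// ltr1n.
rewrite -lee_fin; apply: le_trans (H s _ lt_d); last by rewrite /itv_family al.
rewrite -sumEFin big_seq [leRHS]big_seq; apply: lee_sum => x xs.
have /andP[/andP[x0 x12] x1] := allP al _ xs.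
rewrite -VB// ger0_norm// (le_trans _ (Vle _ _ x0 x12 x1))//.
Qed.

Lemma abs_cont_onB f g : abs_cont_on 0 1 f -> abs_cont_on 0 1 g ->
  abs_cont_on 0 1 (f \- g).
Proof.
move=> af ag e e0; have e20 : 0 < e / 2 by rewrite divr_gt0.
have [d1 d10 H1] := af _ e20; have [d2 d20 H2] := ag _ e20.
exists (Num.min d1 d2); first by rewrite lt_min d10.
move=> s al pw; rewrite lt_min => /andP[lt1 lt2].
rewrite [e]splitr; apply: le_lt_trans (ltrD (H1 s al pw lt1) (H2 s al pw lt2)).
rewrite -big_split/=; apply: ler_sum => x _.
have -> : (f \- g) x.2 - (f \- g) x.1 = (f x.2 - f x.1) - (g x.2 - g x.1) by rewrite /=; ring.
exact: ler_normB.
Qed.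

End total_variation_abs_cont.

(** * Uniform grids of left-open cells, and clamping to the unit interval *)

Definition cell {R : realType} (k i : nat) : set R :=
  `](i%:R / k.+1%:R), (i.+1%:R / k.+1%:R)]%classic.

Section cells.
Variable R : realType.
Implicit Types (k i : nat) (x y : R).
Local Notation mu := (@lebesgue_measure R).

Lemma cell_le k i : i%:R / k.+1%:R <= i.+1%:R / k.+1%:R :> R.
Proof. by rewrite ler_pM2r ?invr_gt0// ler_nat. Qed.

Lemma cell_ge0 k i : 0 <= i%:R / k.+1%:R :> R.
Proof. by rewrite divr_ge0. Qed.

Lemma cell_le1 k i : (i < k.+1)%N -> i.+1%:R / k.+1%:R <= 1 :> R.
Proof. by move=> ik; rewrite ler_pdivrMr// mul1r ler_nat. Qed.

Lemma cell_length k i : i.+1%:R / k.+1%:R - i%:R / k.+1%:R = k.+1%:R^-1 :> R.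
Proof. by rewrite -mulrBl -natrB// subSnn mul1r. Qed.

Lemma measurable_cell k i : measurable (cell k i : set R).
Proof. exact: measurable_itv. Qed.

Lemma trivIset_cell k : trivIset [set: nat] (cell k : nat -> set R).
Proof.
apply/trivIsetP => i j _ _.
wlog : i j / (i < j)%N.
  move=> H ij; have [/H->//|/H|] := ltngtP i j.
    by rewrite eq_sym setIC; apply.
  by move=> e; rewrite e eqxx in ij.
move=> ij _; rewrite -subset0 => x []; rewrite /cell/= !in_itv/= => /andP[_ h1] /andP[h2 _].
have := lt_le_trans h2 h1; rewrite ltr_pM2r ?invr_gt0// ltr_nat ltnS.
by rewrite leqNgt ij.
Qed.

Lemma cell_cover k x : 0 < x -> x <= 1 -> exists2 i, (i < k.+1)%N & cell k i x.
Proof.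
move=> x0 x1; have ex : exists i, x <= i.+1%:R / k.+1%:R.
  by exists k; rewrite divff ?pnatr_eq0.
case: (ex_minnP ex) => i xi imin; exists i.
  by rewrite ltnS imin// divff ?pnatr_eq0.
rewrite /cell/= in_itv/= xi andbT; case: i imin {xi} => [|i] imin.
  by rewrite mul0r.
by rewrite ltNge; apply/negP => /imin; rewrite ltnn.
Qed.

Lemma cell_close k i x y : cell k i x -> cell k i y -> `|x - y| < k.+1%:R^-1.
Proof.
rewrite /cell/= !in_itv/= => /andP[x1 x2] /andP[y1 y2].
have L := cell_length k i.
set a := i%:R / _ in L x1 y1 *; set b := i.+1%:R / _ in L x2 y2 *.
rewrite -L ltr_norml; apply/andP; split; lra.
Qed.

Lemma lebesgue_measure_cell k i : mu (cell k i) = (k.+1%:R^-1)%:E.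
Proof.
rewrite /cell lebesgue_measure_itv/= lte_fin ltr_pM2r ?invr_gt0//.
by rewrite ltr_nat leqnn -EFinB cell_length.
Qed.

End cells.

(** Composition with [clamp01] extends a function on the unit interval by its end values. Global
    notions such as continuity on the line or Stieltjes measures then apply to it. *)
Definition clamp01 {R : realType} (t : R) : R := Num.max 0 (Num.min t 1).

Section clamp01.
Variable R : realType.
Implicit Types s t : R.

Lemma clamp01_ge0 t : 0 <= clamp01 t. Proof. by rewrite /clamp01 le_max lexx. Qed.

Lemma clamp01_le1 t : clamp01 t <= 1.
Proof. by rewrite /clamp01 ge_max ler01 ge_min lexx orbT. Qed.

Lemma clamp01E t : 0 <= t -> t <= 1 -> clamp01 t = t.
Proof. by move=> t0 t1; rewrite /clamp01 min_l// max_r. Qed.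

Lemma clamp01_homo s t : s <= t -> clamp01 s <= clamp01 t.
Proof.
move=> st; rewrite /clamp01; case: (leP s 1) => ?; case: (leP t 1) => ?;
rewrite ?(max_r ler01); case: (leP 0 s) => ?; case: (leP 0 t) => ?; lra.
Qed.

Lemma clamp01_lip s t : s <= t -> clamp01 t - clamp01 s <= t - s.
Proof.
move=> st; rewrite /clamp01; case: (leP s 1) => ?; case: (leP t 1) => ?;
rewrite ?(max_r ler01); case: (leP 0 s) => ?; case: (leP 0 t) => ?; lra.
Qed.

End clamp01.

(** * Densities of monotone absolutely continuous functions *)

Section monotone_density.
Variables (R : realType) (F : R -> R).
Hypothesis ndF : forall s t, 0 <= s -> s <= t -> t <= 1 -> F s <= F t.
Hypothesis acF : abs_cont_on 0 1 F.
Local Notation mu := (@lebesgue_measure R).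

Let G t := F (clamp01 t).

Let Gnd : {homo G : x y / x <= y}.
Proof. by move=> x y xy; apply: ndF; [exact: clamp01_ge0|exact: clamp01_homo|exact: clamp01_le1]. Qed.

Let Grc : right_continuous G.
Proof.
move=> x; apply/cvgrPdist_le => e e0; have [d d0 H] := acF e0.
near=> y.
have xy : x <= y by near: y; apply: nbhs_right_ge.
have yd : y - x < d.
  by rewrite ltrBlDl; near: y; apply: nbhs_right_lt; rewrite ltrDl.
rewrite distrC; have := H [:: (clamp01 x, clamp01 y)].
rewrite !big_seq1 /= clamp01_ge0 clamp01_homo// clamp01_le1 => /(_ isT isT) h.
by apply/ltW/h/(le_lt_trans _ yd)/clamp01_lip.
Unshelve. all: by end_near. Qed.

Lemma clamped_cumulative : exists H : cumulative R R, forall t, H t = G t.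
Proof. by exists (HB.pack_for (cumulative R R) G (isCumulative.Build R _ R G Gnd Grc)). Qed.

Local Notation measR := (@measurable _ (measurableTypeR R)).

Section stieltjes.
Variable GC : cumulative R R.
Hypothesis GCE : forall t, GC t = G t.
Let lam : {measure set (measurableTypeR R) -> \bar R} := lebesgue_stieltjes_measure GC.

Let lam_itv a b : a <= b -> lam `]a, b]%classic = (G b - G a)%:E.
Proof.
move=> ab; rewrite /lam /= /lebesgue_stieltjes_measure/= /measure_extension/=.
rewrite measurable_mu_extE/=; last exact: is_ocitv.
by rewrite wlength_itv_bnd// !GCE.
Qed.

Let D01 := (`]0, 1]%classic : set R).
Let mD01 : measR D01. Proof. exact: measurable_itv. Qed.
Let lamD01 : (lam D01 < +oo)%E. Proof. by rewrite lam_itv// ltry. Qed.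

Section open_bound.
Variables (U : set R) (oU : open U) (e d : R).
Hypothesis dP : forall s, itv_family 0 1 s -> \sum_(x <- s) (x.2 - x.1) < d ->
    \sum_(x <- s) `|F x.2 - F x.1| < e.
Hypothesis Ud : (mu U < d%:E)%E.

(** The cells of one grid that lie inside [U] form a finite disjoint family of total length at most
    [mu U], to which [dP] applies directly. They stand in for the countable decomposition of [U]
    into its components. *)
Let P k i := `[< cell k i `<=` U >].
Let cellU k i : set R := if P k i then cell k i else set0.
Let Gk k := \big[setU/set0]_(i < k.+1) cellU k i.

Let mU : measR U. Proof. exact: open_measurable. Qed.

Let mcellU k i : measR (cellU k i).
Proof. by rewrite /cellU; case: ifP => // _; exact: measurable_cell. Qed.

Let triv k : trivIset [set: nat] (cellU k).
Proof.
apply/trivIsetP => i j _ _ ij; rewrite /cellU.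
do 2 (case: ifP => _; rewrite ?setI0 ?set0I//).
by move/trivIsetP : (@trivIset_cell R k); exact.
Qed.

Let mGk k : measR (Gk k).
Proof. by apply: bigsetU_measurable => i _; exact: mcellU. Qed.

Let GkU k : Gk k `<=` U.
Proof.
rewrite /Gk => x; rewrite -bigcup_mkord => -[i _]; rewrite /cellU.
by case: ifP => // /asboolP; exact.
Qed.

Let muGk k : mu (Gk k) = (\sum_(i < k.+1 | P k i) k.+1%:R^-1)%:E.
Proof.
rewrite /Gk measure_bigsetU// [in RHS]big_mkcond -sumEFin; apply: eq_bigr => i _.
rewrite /cellU; case: ifP => _; first exact: lebesgue_measure_cell.
by rewrite measure0.
Qed.

Let lamGk k : lam (Gk k) = (\sum_(i < k.+1 | P k i)
   (F (i.+1%:R / k.+1%:R) - F (i%:R / k.+1%:R)))%:E.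
Proof.
rewrite /Gk measure_bigsetU//.
rewrite [in RHS]big_mkcond -sumEFin; apply: eq_bigr => i _.
rewrite /cellU; case: ifP => _; last by rewrite measure0.
apply: etrans (lam_itv (cell_le R k i)) _; rewrite /G !clamp01E// ?cell_ge0 ?cell_le1//.
by rewrite (le_trans (cell_le _ _ _))// cell_le1.
Qed.

Let lamGk_le k : (lam (Gk k) <= e%:E)%E.
Proof.
pose s : seq (R * R) := [seq (i%:R / k.+1%:R, i.+1%:R / k.+1%:R) | i <- iota 0 k.+1 & P k i].
rewrite lamGk lee_fin.
have sE (h : R * R -> R) :
    \sum_(x <- s) h x = \sum_(i < k.+1 | P k i) h (i%:R / k.+1%:R, i.+1%:R / k.+1%:R).
  rewrite /s big_map big_filter.
  by rewrite -(big_mkord (P k) (fun i => h (i%:R / k.+1%:R, i.+1%:R / k.+1%:R))) /index_iota subn0.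
apply: le_trans (_ : \sum_(x <- s) `|F x.2 - F x.1| <= _).
  by rewrite sE; apply: ler_sum => i _; exact: ler_norm.
apply/ltW/dP; last first.
  rewrite sE /=; under eq_bigr do rewrite cell_length.
  rewrite -lte_fin -muGk (le_lt_trans _ Ud)// le_measure// inE; [exact: mGk|exact: mU].
apply/andP; split.
  apply/allP => x /mapP[i]; rewrite mem_filter mem_iota add0n => /andP[_ /andP[_ ik]] ->.
  by rewrite /= cell_ge0 cell_le cell_le1.
rewrite /s pairwise_map; apply: (@sub_pairwise _ ltn).
  by move=> i j /= ij; rewrite ler_pM2r ?invr_gt0// ler_nat ij.
by rewrite -sorted_pairwise ?sorted_filter ?iota_ltn_sorted//; exact: ltn_trans.
Qed.

Lemma stieltjes_open_le : (lam (U `&` D01) <= e%:E)%E.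
Proof.
(* Successive grids are not nested, so [Gk] need not increase. The tail intersections do, and each
   point of [U] in []0, 1]] belongs to one of them: from some mesh on, the cell around it fits into
   a ball inside [U]. *)
pose T n := \bigcap_(k in [set k | (n <= k)%N]) Gk k.
have mT n : measR (T n).
  by apply: bigcap_measurable => //; exists n => /=.
have lamT n : (lam (T n) <= e%:E)%E.
  apply: le_trans (lamGk_le n); rewrite le_measure ?inE//.
  by move=> x Tx; apply: Tx => /=.
have mUT : measR (\bigcup_n T n) by exact: bigcupT_measurable.
have ndT : {homo T : n m / (n <= m)%N >-> (n <= m)%O}.
  by move=> n m nm; apply/subsetPset => x Tx k /= mk; apply: Tx => /=; exact: leq_trans mk.
have cT := @nondecreasing_cvg_mu _ _ _ lam _ mT mUT ndT.
apply: (@le_trans _ _ (lam (\bigcup_n T n))).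
  apply: le_measure; rewrite ?inE//; first exact: measurableI.
  move=> x [Ux]; rewrite /D01/= in_itv/= => /andP[x0 x1].
  have [r /= r0 xrU] : nbhs_ball x U by rewrite nbhs_ballE; exact: open_nbhs_nbhs.
  have [n _ nr] := near_infty_natSinv_lt (PosNum r0).
  exists n => // k /= nk; have [i ik xi] := cell_cover k x0 x1.
  rewrite /Gk -bigcup_mkord; exists i => //; rewrite /cellU; case: ifP => //.
  move/negP; case; apply/asboolP => y yi; apply: xrU.
  by rewrite /ball/= (lt_trans (cell_close xi yi))//; exact: nr.
rewrite -(cvg_lim _ cT)//; apply: lime_le; first by apply/cvg_ex; exists (lam (\bigcup_n T n)).
by near=> n; exact: lamT.
Unshelve. all: by end_near. Qed.

End open_bound.

(** Outer regularity encloses a Lebesgue null set in an open set of measure below [d], whose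
    Stieltjes measure is at most [e]. The Stieltjes measure is therefore dominated by Lebesgue
    measure and has a Radon-Nikodym density. *)
Lemma cumulative_abs_cont_density : exists g, prim F g.
Proof.
pose nu : {finite_measure set (measurableTypeR R) -> \bar R} := mfrestr mD01 lamD01.
have numu : nu `<< mu.
  apply/null_content_dominatesP => A mA muA0.
  apply/eqP; rewrite eq_le measure_ge0 andbT; apply/lee_addgt0Pr => e e0; rewrite add0e.
  have [d d0 H] := acF e0.
  have muAy : (mu A < +oo)%E by rewrite muA0.
  have [U [oU AU UA]] := lebesgue_regularity_outer mA muAy d0.
  have Ud : (mu U < d%:E)%E.
    apply: le_lt_trans UA; rewrite -[in leLHS](setDUK AU).
    rewrite (le_trans (measureU2 _ _ _))//; last by rewrite muA0 add0e.
    by apply: measurableD => //; exact: open_measurable.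
  apply: (@le_trans _ _ (lam (U `&` D01))).
    rewrite /nu/= /mfrestr /mrestr le_measure ?inE//.
    - exact: measurableI.
    - by apply: measurableI => //; exact: open_measurable.
    - exact: setSI.
  apply: stieltjes_open_le Ud => // s /andP[]; exact: H.
have [g [g0 gfin gint gE]] := radon_nikodym_sigma_finite numu.
exists (fine \o g); split.
  apply: eq_integrable (integrableS _ _ _ gint) => //; [exact: measurable_itv| |exact: measurable_itv].
  by move=> x _ /=; rewrite fineK.
move=> s t s0 st t1; rewrite /Rintegral.
rewrite (eq_integral g); last by move=> x _ /=; rewrite fineK.
rewrite -gE; last exact: measurable_itv.
rewrite /nu/= /mfrestr /mrestr setIidl.
  by rewrite lam_itv//= /G !clamp01E// ?(le_trans s0)// (le_trans st).
move=> x; rewrite /D01/= !in_itv/= => /andP[sx xt].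
by rewrite (le_lt_trans s0 sx) (le_trans xt t1).
Qed.

End stieltjes.

Lemma monotone_abs_cont_density : exists g, prim F g.
Proof. by have [GC GCE] := clamped_cumulative; exact: cumulative_abs_cont_density GCE. Qed.

End monotone_density.

(** * Absolutely continuous functions as primitives of their derivatives *)

Section abs_cont_prim.
Variable R : realType.
Implicit Types (f g : R -> R).
Local Notation mu := (@lebesgue_measure R).

Lemma I01_itv s t : 0 <= s -> t <= 1 -> `]s, t]%classic `<=` (@I01 R).
Proof.
move=> s0 t1 x /=; rewrite /I01/= !in_itv/= => /andP[sx xt].
by rewrite (ltW (le_lt_trans s0 sx)) (le_trans xt t1).
Qed.

Lemma prim_integrable_itv f g s t : prim f g -> 0 <= s -> t <= 1 ->
  mu.-integrable `]s, t] (EFin \o g).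
Proof.
move=> [ig _] s0 t1; apply: integrableS ig; [exact: measurable_itv..|exact: I01_itv].
Qed.

(** Write [f] as the difference of the monotone functions [V] and [V \- f] and subtract their
    densities. *)
Lemma abs_cont_prim f : abs_cont_on 0 1 f -> exists g, prim f g.
Proof.
move=> ac; have [V aV Vf] := abs_cont_variation ac.
have [g1 p1] : exists g, prim V g.
  apply: monotone_abs_cont_density => // s t s0 st t1.
  by rewrite -subr_ge0 (le_trans _ (Vf _ _ s0 st t1)).
have [g2 p2] : exists g, prim (V \- f) g.
  apply: monotone_abs_cont_density; last exact: abs_cont_onB.
  move=> s t s0 st t1 /=; have := Vf _ _ s0 st t1.
  have := ler_norm (f t - f s); lra.
exists (g1 \- g2); split.
  apply: integrableB p1.1 p2.1; exact: measurable_itv.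
move=> s t s0 st t1; rewrite RintegralB.
- by rewrite -p1.2// -p2.2//=; ring.
- exact: measurable_itv.
- exact: prim_integrable_itv p1 _ _.
- exact: prim_integrable_itv p2 _ _.
Qed.

(** Lebesgue differentiation applied to [g] extended by zero; near an interior point, [f] is the
    integral from 0 plus the constant [f 0]. *)
Lemma prim_derivable_ae f g : prim f g ->
  {ae mu, forall t, 0 < t < 1 -> derivable f t 1 /\ derive1 f t = g t}.
Proof.
move=> [ig fg]; pose h := g \_ (@I01 R).
have ih A : measurable A -> mu.-integrable A (EFin \o h).
  move=> mA; apply: (@integrableS _ _ _ _ setT) => //.
  rewrite /h -restrict_EFin; apply/integrable_restrict => //; first exact: measurable_itv.
  by rewrite setTI.
have lh : locally_integrable [set: R] h by apply: integrable_locally => //; exact: measurable_itv.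
have := @FTC1 R h (BRight 0) (fun y => ih _ (measurable_itv _)) lh.
move=> /=; apply: (@filterS _ _ (ae_filter_ringOfSetsType mu)) => t /= Ht /andP[t0 t1].
have [d1 d2] := Ht t0.
pose H x := \int[mu]_(t in `]0, x]) h t.
have E : \forall x \near t, H x + f 0 = f x.
  near=> x.
  have x0 : 0 < x by near: x; exact: lt_nbhsr.
  have x1 : x < 1 by near: x; exact: lt_nbhsl.
  have hg : {in `]0, x]%classic, h =1 g}.
    by move=> y; rewrite inE => yx; rewrite /h patchE mem_set//; apply: I01_itv yx => //; exact: ltW.
  have -> : H x = f x - f 0.
    rewrite (fg 0 x (lexx 0) (ltW x0) (ltW x1)) /H.
    by apply: eq_Rintegral => y yx; exact: hg.
  by rewrite subrK.
have D : is_derive t 1 (fun x => H x + f 0) (g t).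
  have -> : g t = h t + 0.
    rewrite addr0 /h patchE mem_set//; rewrite /I01/= in_itv/= (ltW t0) (ltW t1)//.
  by apply: is_deriveD; apply: DeriveDef => //; rewrite -derive1E.
have [df dfE] := near_eq_is_derive E D.
by split => //; rewrite derive1E.
Unshelve. all: by end_near. Qed.

End abs_cont_prim.

(** * Entrywise norms and quadratic forms of matrices *)

(** Two sizes are used side by side: [nrm1] is submultiplicative and integrates entry by entry,
    which suits flow estimates, while [fro2] is the squared Frobenius norm, the density in $J_{\rm
    A}$. *)
Definition nrm1 {R : realType} (m n : nat) (A : 'M[R]_(m, n)) : R :=
  \sum_(p : 'I_m * 'I_n) `|A p.1 p.2|.

Definition fro2 {R : realType} (m n : nat) (A : 'M[R]_(m, n)) : R :=
  \sum_(p : 'I_m * 'I_n) (A p.1 p.2) ^+ 2.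

Definition qf {R : realType} (n p : nat) (W : 'M[R]_n) (V : 'M[R]_(p, n)) : R :=
  \tr (V *m W *m V^T).

Section matrix_norms.
Variable R : realType.
Implicit Types m n p : nat.

Lemma nrm1_ge0 m n (A : 'M[R]_(m, n)) : 0 <= nrm1 A.
Proof. by apply: sumr_ge0. Qed.

Lemma le_nrm1 m n (A : 'M[R]_(m, n)) i j : `|A i j| <= nrm1 A.
Proof. by rewrite /nrm1 (bigD1 (i, j))//= lerDl sumr_ge0. Qed.

Lemma nrm1_eq0 m n (A : 'M[R]_(m, n)) : nrm1 A <= 0 -> A = 0.
Proof.
move=> A0; apply/matrixP => i j; rewrite mxE; apply/eqP.
by rewrite -normr_le0 (le_trans (le_nrm1 _ _ _)).
Qed.

Lemma nrm1_0 m n : nrm1 (0 : 'M[R]_(m, n)) = 0.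
Proof. by rewrite /nrm1 big1// => p _; rewrite mxE normr0. Qed.

Lemma nrm1N m n (A : 'M[R]_(m, n)) : nrm1 (- A) = nrm1 A.
Proof. by apply: eq_bigr => p _; rewrite mxE normrN. Qed.

Lemma ler_nrm1D m n (A B : 'M[R]_(m, n)) : nrm1 (A + B) <= nrm1 A + nrm1 B.
Proof. by rewrite -big_split/=; apply: ler_sum => p _; rewrite mxE ler_normD. Qed.

Lemma nrm1_rows m n (A : 'M[R]_(m, n)) : nrm1 A = \sum_i \sum_j `|A i j|.
Proof. by rewrite pair_big. Qed.

Lemma fro2_rows m n (A : 'M[R]_(m, n)) : fro2 A = \sum_i \sum_j A i j ^+ 2.
Proof. by rewrite pair_big. Qed.

Lemma ler_nrm1M m n p (A : 'M[R]_(m, n)) (B : 'M[R]_(n, p)) :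
  nrm1 (A *m B) <= nrm1 A * nrm1 B.
Proof.
rewrite [nrm1 (_ *m _)]nrm1_rows [nrm1 A]nrm1_rows mulr_suml; apply: ler_sum => i _.
apply: (@le_trans _ _ (\sum_j \sum_k `|A i k| * `|B k j|)).
  apply: ler_sum => j _; rewrite mxE (le_trans (ler_norm_sum _ _ _))//.
  by apply: ler_sum => k _; rewrite normrM.
rewrite exchange_big/= mulr_suml; apply: ler_sum => k _.
rewrite -mulr_sumr ler_wpM2l// nrm1_rows (bigD1 k)//= lerDl sumr_ge0// => ? _.
by rewrite sumr_ge0.
Qed.

Lemma fro2_ge0 m n (A : 'M[R]_(m, n)) : 0 <= fro2 A.
Proof. by apply: sumr_ge0 => p _; rewrite sqr_ge0. Qed.

Lemma mxtrace_fro2 m n (A : 'M[R]_(m, n)) : \tr (A *m A^T) = fro2 A.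
Proof.
rewrite fro2_rows; apply: eq_bigr => i _; rewrite mxE; apply: eq_bigr => j _.
by rewrite mxE expr2.
Qed.

Lemma fro2_eq0 m n (A : 'M[R]_(m, n)) : fro2 A = 0 -> A = 0.
Proof.
move/eqP; rewrite /fro2 psumr_eq0 => [/allP H|p _]; last exact: sqr_ge0.
apply/matrixP => i j; rewrite mxE; apply/eqP.
by have := H (i, j); rewrite mem_index_enum sqrf_eq0 => /(_ isT).
Qed.

Lemma normr_le_sqr (a l : R) : 0 < l -> `|a| <= l * a ^+ 2 + l^-1.
Proof.
move=> l0; rewrite -real_normK ?num_real//.
(* Completing the square would give the constant $1/(4l)$; the summand $3/4$ rounds it up to
   $1/l$. *)
have : 0 <= l^-1 * ((l * `|a| - 2^-1) ^+ 2 + 3 / 4).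
  apply: mulr_ge0; first by rewrite invr_ge0 ltW.
  have := sqr_ge0 (l * `|a| - 2^-1); lra.
have -> : l^-1 * ((l * `|a| - 2^-1) ^+ 2 + 3 / 4) = l * `|a| ^+ 2 - `|a| + l^-1.
  by field; rewrite gt_eqF.
lra.
Qed.

Lemma nrm1_le_fro2 m n (A : 'M[R]_(m, n)) (l : R) : 0 < l ->
  nrm1 A <= l * fro2 A + (m * n)%:R / l.
Proof.
move=> l0; have -> : l * fro2 A + (m * n)%:R / l =
    \sum_(p : 'I_m * 'I_n) (l * A p.1 p.2 ^+ 2 + l^-1).
  rewrite big_split/= -mulr_sumr sumr_const card_prod !card_ord.
  by rewrite mulr_natl.
by apply: ler_sum => p _; exact: normr_le_sqr.
Qed.

(** Cauchy-Schwarz against the constant vector, obtained from $2a_ia_j\le a_i^2+a_j^2$. *)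
Lemma sqr_sum_le n (a : 'I_n -> R) : (\sum_i a i) ^+ 2 <= n%:R * \sum_i a i ^+ 2.
Proof.
rewrite expr2 mulr_suml.
apply: (@le_trans _ _ (\sum_i \sum_j (a i ^+ 2 + a j ^+ 2) / 2)).
  apply: ler_sum => i _; rewrite mulr_sumr; apply: ler_sum => j _.
  have := sqr_ge0 (a i - a j); rewrite sqrrB; lra.
under eq_bigr do rewrite -mulr_suml big_split/= sumr_const card_ord.
rewrite -mulr_suml big_split/= sumr_const card_ord sumrMnl.
by rewrite -mulr_natl le_eqVlt; apply/orP; left; apply/eqP; field.
Qed.

Lemma fro2M_le m n p (Z : 'M[R]_(m, n)) (E : 'M[R]_(n, p)) (e : R) : nrm1 E <= e ->
  fro2 (Z *m E) <= e ^+ 2 * (n%:R * p%:R) * fro2 Z.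
Proof.
move=> Ee; have e0 : 0 <= e by rewrite (le_trans (nrm1_ge0 _) Ee).
rewrite !fro2_rows mulr_sumr; apply: ler_sum => i _.
apply: (@le_trans _ _ (\sum_(j < p) (e ^+ 2 * n%:R * \sum_k Z i k ^+ 2))).
  apply: ler_sum => j _; rewrite mxE.
  apply: le_trans (sqr_sum_le _) _.
  rewrite (_ : e ^+ 2 * n%:R * _ = n%:R * ((\sum_k Z i k ^+ 2) * e ^+ 2)); last by ring.
  rewrite ler_wpM2l//.
  rewrite mulr_suml; apply: ler_sum => k _; rewrite exprMn ler_wpM2l ?sqr_ge0//.
  rewrite -real_normK ?num_real// lerXn2r ?nnegrE// (le_trans (le_nrm1 _ _ _) Ee)//.
rewrite sumr_const card_ord -mulr_natr.
by rewrite le_eqVlt; apply/orP; left; apply/eqP; ring.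
Qed.

Lemma fro2B_le m n (A B : 'M[R]_(m, n)) : fro2 (A - B) <= 2 * fro2 A + 2 * fro2 B.
Proof.
rewrite /fro2 !mulr_sumr -big_split/=; apply: ler_sum => p _; rewrite !mxE.
have := sqr_ge0 (A p.1 p.2 + B p.1 p.2); rewrite sqrrD sqrrB; lra.
Qed.

(** Entrywise $(a+b)^2\le(1+e)a^2+(1+1/e)b^2$, and the second part is at most $(1+1/e)e^2n^2$ times
    [fro2 Z]. As $(1+1/e)e^2=e+e^2\le2e$, the excess over 1 is of order [e]. *)
Lemma fro2_perturb m n (Z : 'M[R]_(m, n)) (E : 'M[R]_n) (e : R) :
  0 < e -> e <= 1 -> nrm1 E <= e ->
  fro2 (Z + Z *m E) <= (1 + e * (1 + 2 * n%:R ^+ 2)) * fro2 Z.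
Proof.
move=> e0 e1 Ee.
apply: (@le_trans _ _ ((1 + e) * fro2 Z + (1 + e^-1) * fro2 (Z *m E))).
  rewrite /fro2 !mulr_sumr -big_split/=; apply: ler_sum => p _; rewrite mxE.
  set a := Z _ _; set b := (_ *m _) _ _.
  have : 0 <= e^-1 * (e * a - b) ^+ 2 by rewrite mulr_ge0 ?sqr_ge0// invr_ge0 ltW.
  have -> : e^-1 * (e * a - b) ^+ 2 = e * a ^+ 2 - 2 * a * b + e^-1 * b ^+ 2.
    by field; rewrite gt_eqF.
  rewrite sqrrD; lra.
have H : (1 + e^-1) * fro2 (Z *m E) <= (1 + e^-1) * (e ^+ 2 * (n%:R * n%:R) * fro2 Z).
  by rewrite ler_wpM2l ?fro2M_le// addr_ge0// invr_ge0 ltW.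
apply: (le_trans (lerD (lexx _) H)).
have -> : (1 + e^-1) * (e ^+ 2 * (n%:R * n%:R) * fro2 Z) = (e ^+ 2 + e) * (n%:R ^+ 2 * fro2 Z).
  by field; rewrite gt_eqF.
have e2 : e ^+ 2 <= e by rewrite expr2 -[leRHS]mulr1 ler_wpM2l// ltW.
have nF : 0 <= n%:R ^+ 2 * fro2 Z by rewrite mulr_ge0 ?sqr_ge0 ?fro2_ge0.
have := ler_wpM2r nF e2; lra.
Qed.

Lemma qf_ge0 n p (S : 'M[R]_n) (V : 'M[R]_(p, n)) : SymPos S -> 0 <= qf S V.
Proof.
move=> [_ S0]; apply: sumr_ge0 => i _.
have -> : (V *m S *m V^T) i i = (((row i V)^T)^T *m S *m (row i V)^T) 0 0.
  rewrite !mxE; apply: eq_bigr => k _; rewrite !mxE; congr (_ * _).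
  by apply: eq_bigr => l _; rewrite !mxE.
have [->|/S0/ltW//] := eqVneq (row i V)^T 0.
by rewrite mulmx0 mxE.
Qed.

(* The tangent inequality of the convex form [qf W], from which Jensen follows. *)
Lemma qf_tangent n p (W : 'M[R]_n) (V V0 : 'M[R]_(p, n)) : W^T = W ->
  0 <= qf W (V - V0) -> 2 * \tr (V *m W *m V0^T) - qf W V0 <= qf W V.
Proof.
move=> WT; rewrite /qf linearB/= !mulmxBl !mulmxBr !linearB/=.
have -> : \tr (V0 *m W *m V^T) = \tr (V *m W *m V0^T).
  by rewrite -mxtrace_tr !trmx_mul trmxK WT mulmxA.
lra.
Qed.

(** If $vY^\top Y=0$ then $|vY^\top|^2=0$, and full column rank of $Y$ gives $v=0$. *)
Lemma gram_unitmx m n (Y : 'M[R]_(n, m)) : \rank Y = m -> Y^T *m Y \in unitmx.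
Proof.
move=> rY; rewrite -row_free_unit -kermx_eq0; apply/eqP/row_matrixP => i.
rewrite row0; set v := row i _.
have vK : v *m (Y^T *m Y) = 0 by rewrite /v -row_mul mulmx_ker row0.
have vY : v *m Y^T = 0.
  by apply: fro2_eq0; rewrite -mxtrace_fro2 trmx_mul trmxK mulmxA -[v *m _ *m _]mulmxA vK mul0mx linear0.
have : row_free Y^T by rewrite /row_free mxrank_tr rY.
by move=> fY; apply: (row_free_inj fY); rewrite mul0mx.
Qed.

(** The rows of [N] span the left kernel of [Y] by a dimension count, so [A = D *m N] for some [D],
    and $N^\top(NN^\top)^{-1}$ is a right inverse of [N] recovering [D]. This explicit formula later
    makes the coefficient curve measurable and square integrable. *)
Lemma annihilator_factor n m (Y : 'M[R]_(n, m)) (N : 'M[R]_(n - m, n)) (A : 'M[R]_n) :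
  (m <= n)%N -> \rank Y = m -> row_free N -> N *m Y = 0 -> A *m Y = 0 ->
  A = A *m N^T *m invmx (N *m N^T) *m N.
Proof.
move=> mn rY fN NY AY.
have uN : N *m N^T \in unitmx.
  by have := @gram_unitmx _ _ N^T; rewrite trmxK mxrank_tr; apply; exact/eqP.
have sAk : (A <= kermx Y)%MS by apply/sub_kermxP.
have sNk : (N <= kermx Y)%MS by apply/sub_kermxP.
have /andP[_ sAN] : (N == kermx Y)%MS.
  by rewrite -mxrank_leqif_eq// mxrank_ker rY; apply/eqP/eqP.
have /submxP[D AE] := submx_trans sAk sAN.
by rewrite [in RHS]AE -[D *m N *m _]mulmxA mulmxK.
Qed.

Lemma trailing_row_free n m (Y0 : 'M[R]_(n, m)) (N0 : 'M[R]_(n - m, n)) :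
  (m <= n)%N -> \rank (row_mx Y0 N0^T) = n -> row_free N0.
Proof.
move=> mn; rewrite -mxrank_tr tr_row_mx trmxK => r.
rewrite /row_free eqn_leq rank_leq_row/= leq_subLR -{1}r.
rewrite -addsmxE (leq_trans (mxrank_adds_leqif _ _))// leq_add2r.
exact: rank_leq_row.
Qed.

End matrix_norms.

(** * Integrals over subintervals of the unit interval *)

Definition meas01 {R : realType} (h : R -> R) : Prop := measurable_fun (@I01 R) h.

Definition int01 {R : realType} (s t : R) (h : R -> R) : \bar R :=
  (\int[@lebesgue_measure R]_(x in `]s, t]) (h x)%:E)%E.

Definition meas_mx {R : realType} (p q : nat) (F : R -> 'M[R]_(p, q)) : Prop :=
  forall i j, meas01 (fun t => F t i j).

Definition prim_mx {R : realType} (p q : nat) (F G : R -> 'M[R]_(p, q)) : Prop :=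
  forall i j, prim (fun t => F t i j) (fun t => G t i j).

Section int01_theory.
Variable R : realType.
Implicit Types (f g h : R -> R) (s t a b c : R).
Local Notation mu := (@lebesgue_measure R).
Local Notation measR := (@measurable _ (measurableTypeR R)).

Lemma measurable_I01 : measR (@I01 R).
Proof. exact: measurable_itv. Qed.

Lemma lebesgue_measure_oc s t : s <= t -> mu `]s, t]%classic = (t - s)%:E.
Proof.
move=> st; rewrite lebesgue_measure_itv/= lte_fin; case: ltP => //= ts.
by rewrite (@le_anti _ _ s t) ?st// subrr.
Qed.

Lemma lebesgue_measure_I01 : mu (@I01 R) = 1%:E.
Proof. by rewrite /I01 lebesgue_measure_itv/= lte01 -EFinB subr0. Qed.

Lemma aeS (P Q : R -> Prop) : (forall x, P x -> Q x) ->
  {ae mu, forall x, P x} -> {ae mu, forall x, Q x}.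
Proof. exact: (@filterS _ _ (ae_filter_ringOfSetsType mu)). Qed.

Lemma aeI (P Q : R -> Prop) : {ae mu, forall x, P x} -> {ae mu, forall x, Q x} ->
  {ae mu, forall x, P x /\ Q x}.
Proof. exact: (@filterI _ _ (ae_filter_ringOfSetsType mu)). Qed.

Lemma meas01_cst c : meas01 (fun=> c).
Proof. exact: measurable_cst. Qed.

Lemma meas01D f g : meas01 f -> meas01 g -> meas01 (fun x => f x + g x).
Proof. exact: measurable_funD. Qed.

Lemma meas01B f g : meas01 f -> meas01 g -> meas01 (fun x => f x - g x).
Proof. exact: measurable_funB. Qed.

Lemma meas01M f g : meas01 f -> meas01 g -> meas01 (fun x => f x * g x).
Proof. exact: measurable_funM. Qed.

Lemma meas01X f k : meas01 f -> meas01 (fun x => f x ^+ k).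
Proof. exact: measurable_funX. Qed.

Lemma meas01_norm f : meas01 f -> meas01 (fun x => `|f x|).
Proof. by move=> mf; apply: measurableT_comp mf; exact: normr_measurable. Qed.

Lemma meas01_sum (I : finType) (F : I -> R -> R) :
  (forall i, meas01 (F i)) -> meas01 (fun x => \sum_i F i x).
Proof. by move=> mF; exact: measurable_sum. Qed.

Lemma meas01_itv f s t : meas01 f -> 0 <= s -> t <= 1 ->
  measurable_fun (`]s, t]%classic : set (measurableTypeR R)) (EFin \o f).
Proof.
move=> mf s0 t1; apply/measurable_EFinP.
by apply: measurable_funS mf; [exact: measurable_I01|exact: I01_itv].
Qed.

Lemma int01_ge0 s t h : (forall x, 0 <= h x) -> (0 <= int01 s t h)%E.
Proof. by move=> h0; apply: integral_ge0 => x _; rewrite lee_fin. Qed.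

Lemma le_int01 s t f g : 0 <= s -> t <= 1 -> meas01 f -> meas01 g ->
  (forall x, s < x <= t -> 0 <= f x /\ f x <= g x) -> (int01 s t f <= int01 s t g)%E.
Proof.
move=> s0 t1 mf mg fg; apply: ge0_le_integral.
- exact: measurable_itv.
- by move=> x /=; rewrite in_itv/= lee_fin => /fg[].
- exact: meas01_itv.
- exact: meas01_itv.
- by move=> x /=; rewrite in_itv/= lee_fin => /fg[].
Qed.

Lemma int01Z s t c h : 0 <= s -> t <= 1 -> meas01 h -> (forall x, 0 <= h x) -> 0 <= c ->
  int01 s t (fun x => c * h x) = (c%:E * int01 s t h)%E.
Proof.
move=> s0 t1 mh h0 c0; rewrite /int01 -ge0_integralZl_EFin//.
- by move=> x _; rewrite lee_fin.
- exact: meas01_itv.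
Qed.

Lemma int01D s t f g : 0 <= s -> t <= 1 -> meas01 f -> meas01 g ->
  (forall x, 0 <= f x) -> (forall x, 0 <= g x) ->
  int01 s t (fun x => f x + g x) = (int01 s t f + int01 s t g)%E.
Proof.
move=> s0 t1 mf mg f0 g0; rewrite /int01 -ge0_integralD//.
- by move=> x _; rewrite lee_fin.
- exact: meas01_itv.
- by move=> x _; rewrite lee_fin.
- exact: meas01_itv.
Qed.

Lemma int01_sum (I : finType) s t (F : I -> R -> R) : 0 <= s -> t <= 1 ->
  (forall i, meas01 (F i)) -> (forall i x, 0 <= F i x) ->
  int01 s t (fun x => \sum_i F i x) = (\sum_i int01 s t (F i))%E.
Proof.
move=> s0 t1 mF F0; rewrite /int01.
rewrite -(@ge0_integral_sum _ _ _ mu _ _ _ (fun i x => (F i x)%:E)).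
- by apply: eq_integral => x _; rewrite sumEFin.
- exact: measurable_itv.
- by move=> i; exact: meas01_itv.
- by move=> i x _; rewrite lee_fin.
Qed.

Lemma int01_cst s t c : s <= t -> int01 s t (fun=> c) = (c * (t - s))%:E.
Proof.
move=> st; rewrite /int01 integral_cst; last exact: measurable_itv.
by rewrite EFinM; congr (_ * _)%E; exact: lebesgue_measure_oc.
Qed.

Lemma int01_subitv s t a b h : 0 <= a -> a <= s -> t <= b -> b <= 1 ->
  meas01 h -> (forall x, 0 <= h x) -> (int01 s t h <= int01 a b h)%E.
Proof.
move=> a0 as_ tb b1 mh h0; apply: ge0_subset_integral.
- exact: measurable_itv.
- exact: measurable_itv.
- exact: meas01_itv.
- by move=> x _; rewrite lee_fin.
- move=> x /=; rewrite !in_itv/= => /andP[sx xt].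
  by rewrite (le_lt_trans as_ sx) (le_trans xt tb).
Qed.

(** Each interval is cut out of the domain before the next is treated; disjointness keeps the
    remaining ones inside what is left. *)
Lemma family_integral_le (h : R -> \bar R) (D : set (measurableTypeR R)) (l : seq (R * R)) :
  measR D -> measurable_fun D h -> (forall x, D x -> (0 <= h x)%E) ->
  (forall x, x \in l -> `]x.1, x.2]%classic `<=` D) ->
  pairwise (fun x y => (x.2 <= y.1) || (y.2 <= x.1)) l ->
  (\sum_(x <- l) \int[mu]_(y in `]x.1, x.2]) h y <= \int[mu]_(y in D) h y)%E.
Proof.
elim: l D => [|x l IH] D mD mh h0 sub /= => [_|/andP[pwx pw]].
  by rewrite big_nil integral_ge0.
set J := (`]x.1, x.2]%classic : set (measurableTypeR R)).
have mJ : measR J by exact: measurable_itv.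
have mDJ : measR (D `\` J) by exact: measurableD.
have JD : J `<=` D by apply: sub; rewrite mem_head.
have DE : D = J `|` (D `\` J) by rewrite setDUK.
rewrite big_cons [in leRHS]DE ge0_integral_setU//; last 3 first.
- by rewrite -DE.
- by rewrite -DE.
- by apply/disj_setPS; rewrite setDE setICA setICr setI0.
apply: leeD => //; apply: IH => //.
- by apply: measurable_funS mh.
- by move=> y [/h0].
- move=> y yl z zy; split; first by apply: sub zy; rewrite inE yl orbT.
  rewrite /J /= in_itv/= => /andP[xz zx]; move: zy; rewrite /= in_itv/= => /andP[yz zy].
  by have /orP[|] := allP pwx _ yl; rewrite leNgt => /negP; apply; [exact: lt_le_trans zx|exact: lt_le_trans zy].
Qed.

Lemma family_int01_le h (l : seq (R * R)) : meas01 h -> (forall x, 0 <= h x) ->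
  itv_family 0 1 l ->
  (\sum_(x <- l) int01 x.1 x.2 h <= \int[mu]_(y in @I01 R) (h y)%:E)%E.
Proof.
move=> mh h0 /andP[al pw]; apply: family_integral_le => //.
- exact: measurable_I01.
- exact/measurable_EFinP.
- by move=> x _; rewrite lee_fin.
- by move=> x /(allP al)/andP[/andP[x0 _] x1]; exact: I01_itv.
Qed.

Lemma int01_le_I01 s t h : 0 <= s -> t <= 1 -> meas01 h -> (forall x, 0 <= h x) ->
  (int01 s t h <= \int[mu]_(y in @I01 R) (h y)%:E)%E.
Proof.
move=> s0 t1 mh h0; apply: ge0_subset_integral.
- exact: measurable_itv.
- exact: measurable_I01.
- exact/measurable_EFinP.
- by move=> x _; rewrite lee_fin.
- exact: I01_itv.
Qed.

End int01_theory.

(** * Calculus of primitives *)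

Section prim_theory.
Variable R : realType.
Implicit Types (f g h : R -> R) (s t a b c : R).
Local Notation mu := (@lebesgue_measure R).

Lemma prim_meas01 f g : prim f g -> meas01 g.
Proof. by move=> [/integrableP[mg _] _]; exact/measurable_EFinP. Qed.

Lemma primE f g s t : prim f g -> 0 <= s -> s <= t -> t <= 1 ->
  (f t - f s)%:E = int01 s t g.
Proof.
move=> pfg s0 st t1; rewrite pfg.2// /Rintegral fineK//.
apply: integrable_fin_num; first exact: measurable_itv.
exact: prim_integrable_itv pfg s0 t1.
Qed.

Lemma prim_norm_le f g s t : prim f g -> 0 <= s -> s <= t -> t <= 1 ->
  (`|f t - f s|%:E <= int01 s t (fun x => `|g x|%R))%E.
Proof.
move=> pfg s0 st t1; rewrite -abse_EFin (primE pfg)//.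
apply: le_abse_integral; first exact: measurable_itv.
exact: (meas01_itv (prim_meas01 pfg) s0 t1).
Qed.

Lemma primD f1 g1 f2 g2 : prim f1 g1 -> prim f2 g2 ->
  prim (fun t => f1 t + f2 t) (fun t => g1 t + g2 t).
Proof.
move=> p1 p2; split.
  by apply: integrableD p1.1 p2.1; exact: measurable_I01.
move=> s t s0 st t1; rewrite RintegralD.
- by rewrite -p1.2// -p2.2//; ring.
- exact: measurable_itv.
- exact: prim_integrable_itv p1 _ _.
- exact: prim_integrable_itv p2 _ _.
Qed.

Lemma primZ c f g : prim f g -> prim (fun t => c * f t) (fun t => c * g t).
Proof.
move=> p; split.
  by apply: integrableZl p.1; exact: measurable_I01.
move=> s t s0 st t1; rewrite RintegralZl.
- by rewrite -p.2// mulrBr.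
- exact: measurable_itv.
- exact: prim_integrable_itv p _ _.
Qed.

Lemma prim_id : prim (@id R) (fun=> 1).
Proof.
split.
  apply/integrableP; split; first exact/measurable_EFinP/measurable_cst.
  rewrite (eq_integral (cst 1%:E)) => [|x _]; last by rewrite /= normr1.
  rewrite integral_cst; last exact: measurable_I01.
  by rewrite mul1e; apply: le_lt_trans (ltry 1); rewrite -lebesgue_measure_I01.
move=> s t s0 st t1; rewrite Rintegral_cst; last exact: measurable_itv.
by rewrite mul1r -[LHS]/(fine (t - s)%:E); congr fine; apply/esym/lebesgue_measure_oc.
Qed.

Lemma prim_cst c : prim (fun=> c) (fun=> 0).
Proof.
split; first exact: integrable0.
by move=> s t s0 st t1; rewrite subrr Rintegral_cst ?mul0r//; exact: measurable_itv.
Qed.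

Lemma prim_sum (I : Type) (r : seq I) (F G : I -> R -> R) :
  (forall i, prim (F i) (G i)) ->
  prim (fun t => \sum_(i <- r) F i t) (fun t => \sum_(i <- r) G i t).
Proof.
move=> p; elim: r => [|i r IH].
  rewrite (_ : (fun t => _) = (fun=> 0)); last by apply/funext => t; rewrite big_nil.
  rewrite (_ : (fun t => \sum_(i <- [::]) G i t) = (fun=> 0)); first exact: prim_cst.
  by apply/funext => t; rewrite big_nil.
rewrite (_ : (fun t => _) = (fun t => F i t + \sum_(i <- r) F i t)); last first.
  by apply/funext => t; rewrite big_cons.
rewrite (_ : (fun t => \sum_(i <- i :: r) G i t) = (fun t => G i t + \sum_(i <- r) G i t)).
  exact: primD.
by apply/funext => t; rewrite big_cons.
Qed.

Lemma eq_prim f f' g g' : prim f g -> (forall t, 0 <= t <= 1 -> f t = f' t) ->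
  meas01 g' -> {ae mu, forall t, @I01 R t -> g t = g' t} -> prim f' g'.
Proof.
move=> p ff' mg' gg'.
have ae : ae_eq mu (@I01 R) (EFin \o g) (EFin \o g').
  by apply: aeS gg' => t H /H /= ->.
split.
  have /integrableP[mg ig] := p.1; apply/integrableP; split; first exact/measurable_EFinP.
  apply: le_lt_trans ig; rewrite le_eqVlt; apply/orP; left; apply/eqP; apply: ae_eq_integral.
  - exact: measurable_I01.
  - by apply: measurableT_comp => //; exact/measurable_EFinP.
  - exact: measurableT_comp.
  - by apply: aeS gg' => t H /H /= ->.
move=> s t s0 st t1; rewrite -(ff' t) ?(le_trans s0 st)// -(ff' s) ?s0 ?(le_trans st)// p.2//.
congr fine; apply: ae_eq_integral.
- exact: measurable_itv.
- exact: (meas01_itv (prim_meas01 p) s0 t1).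
- exact: meas01_itv.
- apply: aeS gg' => x H xst /=; rewrite H//; exact: I01_itv xst.
Qed.

End prim_theory.

(** * Linear flows with square-integrable generators *)

Section prim_mx_theory.
Variable R : realType.
Implicit Types (s t a b c : R) (p q r : nat).
Local Notation mu := (@lebesgue_measure R).

Lemma meas_mxM p q r (F : R -> 'M[R]_(p, q)) (G : R -> 'M[R]_(q, r)) :
  meas_mx F -> meas_mx G -> meas_mx (fun t => F t *m G t).
Proof.
move=> mF mG i j; rewrite /meas01; under eq_fun do rewrite mxE.
by apply: meas01_sum => k; exact: meas01M.
Qed.

Lemma meas_mxB p q (F G : R -> 'M[R]_(p, q)) :
  meas_mx F -> meas_mx G -> meas_mx (fun t => F t - G t).
Proof. by move=> mF mG i j; rewrite /meas01; under eq_fun do rewrite !mxE; exact: meas01B. Qed.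

Lemma meas_mx_cst p q (A : 'M[R]_(p, q)) : meas_mx (fun=> A).
Proof. by move=> i j; exact: meas01_cst. Qed.

Lemma meas_mx_tr p q (F : R -> 'M[R]_(p, q)) : meas_mx F -> meas_mx (fun t => (F t)^T).
Proof. by move=> mF i j; rewrite /meas01; under eq_fun do rewrite mxE; exact: mF. Qed.

Lemma meas_mx_nrm1 p q (F : R -> 'M[R]_(p, q)) : meas_mx F -> meas01 (fun t => nrm1 (F t)).
Proof. by move=> mF; apply: meas01_sum => k; apply: (@meas01_norm _ (fun t => F t k.1 k.2)); exact: mF. Qed.

Lemma meas_mx_fro2 p q (F : R -> 'M[R]_(p, q)) : meas_mx F -> meas01 (fun t => fro2 (F t)).
Proof. by move=> mF; apply: meas01_sum => k; apply: (@meas01X _ (fun t => F t k.1 k.2)); exact: mF. Qed.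

Lemma meas_mx_trace p (F : R -> 'M[R]_p) : meas_mx F -> meas01 (fun t => \tr (F t)).
Proof. by move=> mF; apply: meas01_sum => k; exact: mF. Qed.

Lemma prim_mx_meas p q (F G : R -> 'M[R]_(p, q)) : prim_mx F G -> meas_mx G.
Proof. by move=> pFG i j; exact: prim_meas01 (pFG i j). Qed.

Lemma prim_mx_mulr p q r (F G : R -> 'M[R]_(p, q)) (C : 'M[R]_(q, r)) :
  prim_mx F G -> prim_mx (fun t => F t *m C) (fun t => G t *m C).
Proof.
move=> pFG i j; under eq_fun do rewrite mxE; under [X in prim _ X]eq_fun do rewrite mxE.
apply: prim_sum => k; under eq_fun do rewrite mulrC; under [X in prim _ X]eq_fun do rewrite mulrC.
exact/primZ/pFG.
Qed.

Lemma prim_mxB p q (F G F' G' : R -> 'M[R]_(p, q)) : prim_mx F G -> prim_mx F' G' ->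
  prim_mx (fun t => F t - F' t) (fun t => G t - G' t).
Proof.
move=> p1 p2 i j; under eq_fun do rewrite !mxE -mulN1r.
under [X in prim _ X]eq_fun do rewrite !mxE -mulN1r.
by apply: primD; [exact: p1|apply: primZ; exact: p2].
Qed.

Lemma prim_mx_trace p (F G : R -> 'M[R]_p) : prim_mx F G ->
  prim (fun t => \tr (F t)) (fun t => \tr (G t)).
Proof. by move=> pFG; apply: prim_sum => i; exact: pFG. Qed.

Lemma prim_mx_nrm1_le p q (F G : R -> 'M[R]_(p, q)) s t : prim_mx F G ->
  0 <= s -> s <= t -> t <= 1 ->
  ((nrm1 (F t - F s))%:E <= int01 s t (fun x => nrm1 (G x)))%E.
Proof.
move=> pFG s0 st t1; have mG := prim_mx_meas pFG.
rewrite /nrm1 int01_sum//; last by move=> k; apply: (@meas01_norm _ (fun t => G t k.1 k.2)); exact: mG.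
rewrite -sumEFin; apply: lee_sum => k _.
rewrite !mxE; exact: (prim_norm_le (pFG k.1 k.2)).
Qed.

(** Jensen's inequality for [qf W]: the tangent inequality at the mean slope [V0] is integrated, and
    since [F] is the primitive of [G] the affine minorant integrates exactly to the left-hand
    side. *)
Lemma qf_jensen n p (W : 'M[R]_n) (F G : R -> 'M[R]_(p, n)) s t :
  W^T = W -> (forall V : 'M[R]_(p, n), 0 <= qf W V) -> prim_mx F G ->
  0 <= s -> s < t -> t <= 1 ->
  (((t - s) * qf W ((t - s)^-1 *: (F t - F s)))%:E <= int01 s t (fun x => qf W (G x)))%E.
Proof.
move=> WT W0 pFG s0 st t1; have ts0 : 0 < t - s by rewrite subr_gt0.
set V0 := _ *: _.
(* The affine minorant evaluated along [G]; the trailing factor 1 is the density of the identity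
   function. *)
pose l x := 2 * \tr (G x *m (W *m V0^T)) + (- qf W V0) * 1.
have pl : prim (fun x => 2 * \tr (F x *m (W *m V0^T)) + (- qf W V0) * x) l.
  apply: primD; last exact/primZ/prim_id.
  by apply/primZ/prim_mx_trace/prim_mx_mulr.
have mq : meas01 (fun x => qf W (G x)).
  have mG := prim_mx_meas pFG.
  apply: meas_mx_trace; apply: meas_mxM; last exact: meas_mx_tr.
  by apply: meas_mxM => //; exact: meas_mx_cst.
have -> : (t - s) * qf W V0 = 2 * \tr (F t *m (W *m V0^T)) + (- qf W V0) * t -
    (2 * \tr (F s *m (W *m V0^T)) + (- qf W V0) * s).
  have : 2 * \tr ((F t - F s) *m (W *m V0^T)) = 2 * ((t - s) * qf W V0).
    rewrite (_ : F t - F s = (t - s) *: V0); last first.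
      by rewrite /V0 scalerA divff ?gt_eqF// scale1r.
    by rewrite -scalemxAl linearZ/= /qf mulmxA.
  rewrite mulmxBl linearB/=; lra.
rewrite (primE pl)//; last exact: ltW.
have mS := measurable_itv `]s, t].
have [->|fin] := eqVneq (int01 s t (fun x => qf W (G x))) +oo%E; first exact: leey.
apply: le_integral => //.
- exact: (prim_integrable_itv pl).
- apply/integrableP; split; first exact: meas01_itv.
  move: fin; rewrite -ltey; apply: le_lt_trans; rewrite le_eqVlt; apply/orP; left; apply/eqP.
  by apply: eq_integral => x _; rewrite gee0_abs// lee_fin.
- move=> x _; rewrite lee_fin /l mulr1 mulmxA.
  exact: qf_tangent.
Qed.

End prim_mx_theory.

(** * Uniform bounds for linear flows *)

Section flows.
Variable R : realType.
Implicit Types (s t a b c C : R) (p q r : nat).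
Local Notation mu := (@lebesgue_measure R).

(* Young's inequality replaces Cauchy-Schwarz here: it is linear, hence sums over families. *)
Lemma family_nrm1_le p q (K : R -> 'M[R]_(p, q)) C c (l : seq (R * R)) :
  meas_mx K -> (\int[mu]_(x in @I01 R) (fro2 (K x))%:E <= C%:E)%E -> 0 < c ->
  itv_family 0 1 l ->
  (\sum_(x <- l) int01 x.1 x.2 (fun y => nrm1 (K y)) <=
   (c * C + (p * q)%:R / c * \sum_(x <- l) (x.2 - x.1))%:E)%E.
Proof.
move=> mK intK c0 fam.
have mF := meas_mx_fro2 mK; have F0 x : 0 <= fro2 (K x) by exact: fro2_ge0.
apply: (@le_trans _ _ (\sum_(x <- l) (c%:E * int01 x.1 x.2 (fun y => fro2 (K y)) +
    ((p * q)%:R / c * (x.2 - x.1))%:E))%E).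
  rewrite big_seq [leRHS]big_seq; apply: lee_sum => x xl.
  have /andP[al _] := fam; have /andP[/andP[x0 x12] x1] := allP al _ xl.
  rewrite -int01Z//; last exact: ltW.
  rewrite -int01_cst// -int01D//; [|exact: meas01M (meas01_cst _) mF|exact: meas01_cst| |]; last 2 first.
  - by move=> y; rewrite mulr_ge0// ltW.
  - by move=> _; rewrite divr_ge0// ltW.
  apply: le_int01 => //; first exact: meas_mx_nrm1.
    by apply: meas01D; [exact: meas01M (meas01_cst _) mF|exact: meas01_cst].
  by move=> y _; split; [exact: nrm1_ge0|exact: nrm1_le_fro2].
rewrite big_split/= sumEFin EFinD mulr_sumr leeD2r//.
rewrite -ge0_sume_distrr; last by move=> x _; exact: int01_ge0.
rewrite EFinM lee_pmul2l//; apply: le_trans intK; exact: family_int01_le.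
Qed.

(** A substitute for Gronwall's inequality. With [m] the supremum of [nrm1 (u r)] on the interval,
    increments are at most [m] times the integral of [nrm1 (K x)], hence at most [m / 2]; so
    [m <= nrm1 (u t) + m / 2] and [m] is absorbed. Nothing distinguishes the two directions of
    time. *)
Lemma flow_local p q (K : R -> 'M[R]_p) (u : R -> 'M[R]_(p, q)) a b :
  meas_mx K -> prim_mx u (fun t => K t *m u t) -> 0 <= a -> b <= 1 ->
  (int01 a b (fun x => nrm1 (K x)) <= (2^-1)%:E)%E ->
  forall s t, a <= s <= b -> a <= t <= b -> nrm1 (u s) <= 2 * nrm1 (u t).
Proof.
move=> mK pu a0 b1 smallK s t sab tab.
have mKu := prim_mx_meas pu.
pose E := [set nrm1 (u r) | r in `[a, b]%classic].
have dist_le (r r' : R) :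
    (nrm1 (u r) <= nrm1 (u r') + nrm1 (u r' - u r)) /\
    (nrm1 (u r') <= nrm1 (u r) + nrm1 (u r' - u r)).
  split; last by rewrite -{1}(subrK (u r) (u r')) addrC ler_nrm1D.
  by rewrite -(nrm1N (_ - _)) opprB -{1}(subrK (u r') (u r)) addrC ler_nrm1D.
(* The absorption needs a finite supremum, which comes from integrability of the derivative
   [K x *m u x]. *)
have Bfin : (\int[mu]_(x in @I01 R) (nrm1 (K x *m u x))%:E < +oo)%E.
  have : mu.-integrable (@I01 R) (fun x => \sum_(k : 'I_p * 'I_q) `|((K x *m u x) k.1 k.2)%:E|)%E.
    apply: integrable_sum; first exact: measurable_I01.
    move=> k _; have := (pu k.1 k.2).1; exact: integrable_abse.
  move=> /integrableP[_]; apply: le_lt_trans; rewrite le_eqVlt; apply/orP; left; apply/eqP.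
  apply: eq_integral => x _; rewrite gee0_abs ?sume_ge0//.
  by rewrite /nrm1 -sumEFin; apply: eq_bigr => k _; rewrite abse_EFin.
have hub : has_ubound E.
  exists (nrm1 (u a) + fine (\int[mu]_(x in @I01 R) (nrm1 (K x *m u x))%:E)) => _ [r /= rab <-].
  move: rab; rewrite in_itv/= => /andP[ar rb].
  have r1 := le_trans rb b1; have r0 := le_trans a0 ar.
  have [_ H] := dist_le a r.
  apply: (le_trans H); rewrite lerD2l -lee_fin fineK; last first.
    rewrite ge0_fin_numE//; apply: integral_ge0 => x _; rewrite lee_fin; exact: nrm1_ge0.
  apply: le_trans (prim_mx_nrm1_le pu a0 ar r1) _.
  by apply: int01_le_I01 => //; [exact: meas_mx_nrm1|move=> x; exact: nrm1_ge0].
set m := sup E.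
have mP (r : R) : a <= r <= b -> nrm1 (u r) <= m.
  by move=> rab; apply: ub_le_sup => //; exists r => //=; rewrite in_itv.
have m0 : 0 <= m by rewrite (le_trans (nrm1_ge0 (u s)) (mP _ sab)).
have inc (r r' : R) : a <= r <= b -> a <= r' <= b -> r <= r' -> nrm1 (u r' - u r) <= m / 2.
  move=> /andP[ar rb] /andP[ar' rb'] rr'; rewrite -lee_fin.
  have r0 := le_trans a0 ar; have r1 := le_trans rb' b1.
  apply: le_trans (prim_mx_nrm1_le pu r0 rr' r1) _.
  apply: (@le_trans _ _ (int01 r r' (fun x => m * nrm1 (K x)))).
    apply: le_int01 => //; first exact: meas_mx_nrm1.
      by apply: meas01M; [exact: meas01_cst|exact: meas_mx_nrm1].
    move=> x /andP[rx xr']; split; first exact: nrm1_ge0.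
    apply: le_trans (ler_nrm1M _ _) _; rewrite mulrC ler_wpM2r ?nrm1_ge0// mP//.
    by rewrite (le_trans ar (ltW rx)) (le_trans xr' rb').
  rewrite int01Z//; [|exact: meas_mx_nrm1|by move=> x; exact: nrm1_ge0].
  rewrite EFinM lee_wpmul2l ?lee_fin//; apply: le_trans smallK.
  by apply: int01_subitv => //; [exact: meas_mx_nrm1|move=> x; exact: nrm1_ge0].
have step (r : R) : a <= r <= b -> nrm1 (u r) <= nrm1 (u t) + m / 2.
  move=> rab; have [rt|/ltW tr] := leP r t.
    have [H _] := dist_le r t.
    by apply: (le_trans H); rewrite lerD2l inc.
  have [_ H] := dist_le t r.
  by apply: (le_trans H); rewrite lerD2l inc.
have mle : m <= nrm1 (u t) + m / 2.
  apply: ge_sup; first by exists (nrm1 (u s)), s => //=; rewrite in_itv.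
  by move=> _ [r + <-]; rewrite /= in_itv/=; exact: step.
have := step _ sab; lra.
Qed.

(** The segment from [s] to [t] is cut into [N.+1] equal steps; each has length at most $1/(N+1)$
    and costs a factor 2. *)
Lemma chain_le (f : R -> R) (N : nat) :
  (forall s t, 0 <= s <= 1 -> 0 <= t <= 1 -> `|s - t| <= N.+1%:R^-1 -> f s <= 2 * f t) ->
  forall s t, 0 <= s <= 1 -> 0 <= t <= 1 -> f s <= 2 ^+ N.+1 * f t.
Proof.
move=> H s t /andP[s0 s1] /andP[t0 t1].
pose r (i : nat) := s + (t - s) * (i%:R / N.+1%:R).
have lam i : (i <= N.+1)%N -> 0 <= (i%:R / N.+1%:R : R) <= 1.
  by move=> iN; rewrite divr_ge0//= ler_pdivrMr// mul1r ler_nat.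
have r01 i : (i <= N.+1)%N -> 0 <= r i <= 1.
  move=> /lam /andP[l0 l1]; rewrite /r; set l := _ / _ in l0 l1 *.
  have := mulr_ge0 s0 l0; have := mulr_ge0 t0 l0.
  have l1' : 0 <= 1 - l by rewrite subr_ge0.
  have h1 := mulr_ge0 s0 l1'.
  have h2 : 0 <= (1 - s) * (1 - l) by rewrite mulr_ge0// subr_ge0.
  have h3 : 0 <= (1 - t) * l by rewrite mulr_ge0// subr_ge0.
  by move=> ? ?; apply/andP; split; lra.
have Hi i : (i <= N.+1)%N -> f s <= 2 ^+ i * f (r i).
  elim: i => [|i IH] iN; first by rewrite /r mul0r mulr0 addr0 expr0 mul1r.
  apply: (le_trans (IH (ltnW iN))); rewrite exprSr -mulrA ler_wpM2l ?exprn_ge0//.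
  apply: H; [exact/r01/ltnW|exact: r01|].
  rewrite /r; have -> : s + (t - s) * (i%:R / N.+1%:R) - (s + (t - s) * (i.+1%:R / N.+1%:R)) =
     (s - t) * N.+1%:R^-1 by rewrite -(cell_length R N i); ring.
  rewrite normrM (ger0_norm (_ : 0 <= N.+1%:R^-1))// ler_piMl//.
  by rewrite ler_norml; apply/andP; split; lra.
by have := Hi _ (leqnn _); rewrite /r divff ?pnatr_eq0// mulr1 addrC subrK.
Qed.

(** The exponent depends only on [p] and [C], not on the generator or the solution. This uniformity
    drives compactness, and with a zero value at one time it yields uniqueness of solutions. *)
Lemma linear_flow_bound p C : 0 <= C -> exists N : nat,
  forall q (K : R -> 'M[R]_p) (u : R -> 'M[R]_(p, q)), meas_mx K ->
  (\int[mu]_(x in @I01 R) (fro2 (K x))%:E <= C%:E)%E ->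
  prim_mx u (fun t => K t *m u t) ->
  forall s t, 0 <= s <= 1 -> 0 <= t <= 1 -> nrm1 (u s) <= 2 ^+ N * nrm1 (u t).
Proof.
(* Young's inequality bounds the integral of [nrm1 (K x)] by an energy term and a length term. The
   weight [c] makes the first at most 1/4, the length [d] the second, together the 1/2 required for
   local absorption. *)
move=> C0; pose c := (4 * (C + 1))^-1.
have c0 : 0 < c by rewrite invr_gt0 mulr_gt0// ltr_wpDl.
have cC : c * C <= 4^-1.
  rewrite /c invfM -mulrA ler_piMr// ler_pdivrMl ?mulr1; last by rewrite ltr_wpDl.
  by rewrite lerDl.
pose d := (4 * ((p * p)%:R / c + 1))^-1.
have pc0 : 0 <= (p * p)%:R / c by rewrite divr_ge0// ltW.
have d0 : 0 < d by rewrite invr_gt0 mulr_gt0// ltr_wpDl.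
have dP : (p * p)%:R / c * d <= 4^-1.
  rewrite /d invfM mulrCA ler_piMr// -[_ * _^-1]/(_ / _) ler_pdivrMr ?mul1r ?lerDl//.
  by rewrite ltr_wpDl.
have [N _ /(_ N (leqnn N)) Nd] := near_infty_natSinv_lt (PosNum d0).
exists N.+1 => q K u mK intK pu; apply: chain_le => s t s01 t01 st.
have small a b : 0 <= a -> a <= b -> b <= 1 -> b - a <= N.+1%:R^-1 ->
    (int01 a b (fun x => nrm1 (K x)) <= (2^-1)%:E)%E.
  move=> a0 ab b1 ba; have := @family_nrm1_le _ _ K C c [:: (a, b)] mK intK c0.
  rewrite !big_seq1/= => /(_ _)H; apply: le_trans (H _) _; first by rewrite /itv_family/= a0 ab b1.
  rewrite lee_fin; have : (p * p)%:R / c * (b - a) <= 4^-1.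
    by apply: le_trans dP; rewrite ler_wpM2l// (le_trans ba)// ltW.
  lra.
move: (s01) (t01) => /andP[s0 s1] /andP[t0 t1].
have [le_st|/ltW le_ts] := leP s t.
  apply: (@flow_local _ _ K u s t mK pu s0 t1); rewrite ?lexx ?le_st//.
  by apply: small => //; move: st; rewrite distrC ger0_norm// subr_ge0.
apply: (@flow_local _ _ K u t s mK pu t0 s1); rewrite ?lexx ?le_ts//.
by apply: small => //; move: st; rewrite ger0_norm// subr_ge0.
Qed.

End flows.

(** * Continuity and differentiability on the closed unit interval *)

Definition cont01 {R : realType} (f : R -> R) : Prop := continuous (f \o clamp01).

Definition cont_mx {R : realType} (p q : nat) (F : R -> 'M[R]_(p, q)) : Prop :=
  forall i j, cont01 (fun t => F t i j).

Section cont01_theory.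
Variable R : realType.
Implicit Types (f g h fd gd : R -> R) (s t : R).
Local Notation mu := (@lebesgue_measure R).

Lemma clamp01_dist s t : `|clamp01 s - clamp01 t| <= `|s - t|.
Proof.
wlog st : s t / s <= t.
  by move=> H; have [/H//|/ltW/H] := leP s t; rewrite distrC (distrC t).
rewrite distrC ger0_norm ?subr_ge0 ?clamp01_homo// (distrC s) ger0_norm ?subr_ge0//.
exact: clamp01_lip.
Qed.

Lemma clamp01_in t : 0 <= clamp01 t <= 1.
Proof. by rewrite clamp01_ge0 clamp01_le1. Qed.

Lemma cont01P f : (forall t, 0 <= t <= 1 -> forall e, 0 < e -> exists2 d, 0 < d &
    forall s, 0 <= s <= 1 -> `|s - t| < d -> `|f s - f t| < e) <-> cont01 f.
Proof.
split=> [H t|cf t t01 e e0].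
  apply/cvgrPdist_lt => e e0; have [d d0 Hd] := H _ (clamp01_in t) _ e0.
  exists d => // s /= st; rewrite distrC; apply: Hd; first exact: clamp01_in.
  by rewrite (le_lt_trans (clamp01_dist _ _))// distrC.
have /cvgrPdist_lt /(_ _ e0) [d d0 Hd] := cf t.
exists d => // s s01 st; move: s01 t01 (Hd s) => /andP[s0 s1] /andP[t0 t1].
by rewrite /= !clamp01E// (distrC (f t)) => H; apply: H; rewrite distrC.
Qed.

Lemma eq_cont01 f g : (forall t, 0 <= t <= 1 -> f t = g t) -> cont01 f -> cont01 g.
Proof.
move=> fg; rewrite /cont01 => cf; rewrite (_ : g \o clamp01 = f \o clamp01)//.
by apply/funext => t /=; rewrite fg// clamp01_in.
Qed.

Lemma cont01_cst (c : R) : cont01 (fun=> c).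
Proof. by move=> t; exact: cvg_cst. Qed.

Lemma cont01D f g : cont01 f -> cont01 g -> cont01 (fun t => f t + g t).
Proof. by move=> cf cg t; exact: cvgD (cf t) (cg t). Qed.

Lemma cont01B f g : cont01 f -> cont01 g -> cont01 (fun t => f t - g t).
Proof. by move=> cf cg t; exact: cvgB (cf t) (cg t). Qed.

Lemma cont01M f g : cont01 f -> cont01 g -> cont01 (fun t => f t * g t).
Proof. by move=> cf cg t; exact: cvgM (cf t) (cg t). Qed.

Lemma cont01V f : (forall t, 0 <= t <= 1 -> f t != 0) -> cont01 f -> cont01 (fun t => (f t)^-1).
Proof. by move=> f0 cf t; apply: cvgV (cf t); exact/f0/clamp01_in. Qed.

Lemma cont01_sum (I : Type) (r : seq I) (F : I -> R -> R) :
  (forall i, cont01 (F i)) -> cont01 (fun t => \sum_(i <- r) F i t).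
Proof.
move=> cF; elim: r => [|i r IH].
  by apply: (@eq_cont01 (fun=> 0)); [move=> t _; rewrite big_nil|exact: cont01_cst].
by apply: eq_cont01 (cont01D (cF i) IH) => t _; rewrite big_cons.
Qed.

Lemma cont01_prod (I : Type) (r : seq I) (F : I -> R -> R) :
  (forall i, cont01 (F i)) -> cont01 (fun t => \prod_(i <- r) F i t).
Proof.
move=> cF; elim: r => [|i r IH].
  by apply: (@eq_cont01 (fun=> 1)); [move=> t _; rewrite big_nil|exact: cont01_cst].
by apply: eq_cont01 (cont01M (cF i) IH) => t _; rewrite big_cons.
Qed.

Lemma cont01_meas f : cont01 f -> meas01 f.
Proof.
move=> cf; apply: (eq_measurable_fun (f \o clamp01)).
  move=> t; rewrite inE /I01/= in_itv/= => /andP[t0 t1]; by rewrite clamp01E.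
by apply: measurable_funTS; exact: continuous_measurable_fun.
Qed.

Lemma cont01_within f s t : cont01 f -> 0 <= s -> t <= 1 -> {within `[s, t], continuous f}.
Proof.
move=> cf s0 t1; apply/subspace_continuousP => x.
rewrite /= in_itv/= => /andP[sx xt]; apply/cvgrPdist_lt => e e0.
have [|d d0 Hd] := (cont01P f).2 cf x _ e e0.
  by rewrite (le_trans s0 sx) (le_trans xt t1).
exists d => // y /= yx; rewrite in_itv/= => /andP[sy yt]; rewrite distrC; apply: Hd.
  by rewrite (le_trans s0 sy) (le_trans yt t1).
by rewrite distrC.
Qed.

Lemma within_cont01 f : {within (@I01 R), continuous f} -> cont01 f.
Proof.
move=> /subspace_continuousP cf; apply/cont01P => t t01 e e0.
have /cf /cvgrPdist_lt /(_ _ e0) [d d0 Hd] : @I01 R t by rewrite /I01/= in_itv.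
exists d => // s s01 st; rewrite distrC; apply: Hd; first by rewrite /ball/= distrC.
by rewrite /I01/= in_itv.
Qed.

Lemma cont01_bounded f : cont01 f -> exists2 B, 0 <= B & forall t, 0 <= t <= 1 -> `|f t| <= B.
Proof.
move=> cf; have cf' : {within `[0, 1], continuous (fun t => `|f t|)}.
  apply: cont01_within => //; move=> t; exact: cvg_norm (cf t).
have [c _ Hc] := EVT_max ler01 cf'; by exists `|f c|.
Qed.

Lemma cont01_integrable f : cont01 f -> mu.-integrable (@I01 R) (EFin \o f).
Proof.
move=> cf; apply: continuous_compact_integrable; first exact: segment_compact.
exact: cont01_within.
Qed.

Lemma abs_cont_cont01 f : abs_cont_on 0 1 f -> cont01 f.
Proof.
move=> ac; apply/cont01P => t /andP[t0 t1] e e0; have [d d0 H] := ac _ e0.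
exists d => // s /andP[s0 s1] std.
have [st|/ltW ts] := leP s t.
  have := H [:: (s, t)]; rewrite !big_seq1/= s0 t1 st distrC => /(_ isT isT); apply.
  by move: std; rewrite distrC ger0_norm// subr_ge0.
have := H [:: (t, s)]; rewrite !big_seq1/= t0 s1 ts => /(_ isT isT); apply.
by move: std; rewrite ger0_norm// subr_ge0.
Qed.

Lemma deriv_on01P f fd : deriv_on01 f fd -> forall t, 0 <= t <= 1 -> forall e, 0 < e ->
  exists2 d, 0 < d & forall s, 0 <= s <= 1 -> s != t -> `|s - t| < d ->
    `|(f s - f t) / (s - t) - fd t| < e.
Proof.
move=> H t t01 e e0; have /cvgrPdist_lt /(_ _ e0) [d d0 Hd] := H _ t01.
exists d => // s s01 st std; rewrite distrC; apply: Hd; first by rewrite /ball/= distrC.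
by split.
Qed.

Lemma deriv_on01_cont01 f fd : deriv_on01 f fd -> cont01 f.
Proof.
move=> H; apply/cont01P => t t01 e e0.
have [d d0 Hd] := deriv_on01P H t01 ltr01.
have c0 : 0 < 1 + `|fd t| by rewrite ltr_wpDr.
exists (Num.min d (e / (1 + `|fd t|))); first by rewrite lt_min d0 divr_gt0.
move=> s s01; rewrite lt_min => /andP[sd se].
have [->|st] := eqVneq s t; first by rewrite subrr normr0.
have := Hd _ s01 st sd; set q := _ / _ => Hq.
have -> : f s - f t = q * (s - t) by rewrite /q mulfVK// subr_eq0.
rewrite normrM; have qle : `|q| <= 1 + `|fd t|.
  by rewrite -[q](subrK (fd t)) (le_trans (ler_normD _ _))// lerD2r ltW.
apply: le_lt_trans (_ : (1 + `|fd t|) * `|s - t| < e); first by rewrite ler_wpM2r.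
by rewrite mulrC -ltr_pdivlMr.
Qed.

Lemma deriv_on01_is_derive f fd t : deriv_on01 f fd -> 0 < t < 1 -> is_derive t 1 f (fd t).
Proof.
move=> H /andP[t0 t1].
have C : (fun h : R => h^-1 *: ((f \o shift t) (h *: (1 : R)) - f t)) @ 0^' --> fd t.
  apply/cvgrPdist_lt => e e0.
  have t01 : 0 <= t <= 1 by rewrite (ltW t0) (ltW t1).
  have [d d0 Hd] := deriv_on01P H t01 e0.
  exists (Num.min d (Num.min t (1 - t))).
    by rewrite /= !lt_min d0 t0 subr_gt0.
  move=> h /=; rewrite sub0r normrN !lt_min => /and3P[hd ht ht'] h0.
  rewrite distrC /shift /= scaler1 [h^-1 *: _]mulrC.
  have -> : h = h + t - t by rewrite addrK.
  rewrite -[(h + t - t) + t]/(h + t - t + t) subrK; apply: Hd.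
  - have := ler_norm h; have := ler_norm (- h); rewrite normrN => ? ?.
    by apply/andP; split; lra.
  - by rewrite -subr_eq0 addrK.
  - by rewrite addrK.
split; first by apply/cvg_ex; exists (fd t).
exact: cvg_lim C.
Qed.

Lemma deriv_on01_prim f fd : deriv_on01 f fd -> cont01 fd -> prim f fd.
Proof.
move=> H cfd; have cf := deriv_on01_cont01 H; split; first exact: cont01_integrable.
move=> s t s0; rewrite le_eqVlt => /predU1P[->|st] t1.
  by rewrite subrr set_itvE Rintegral_set0.
have ifd : mu.-integrable `[s, t] (EFin \o fd).
  apply: integrableS (cont01_integrable cfd); [exact: measurable_itv..|].
  move=> x /=; rewrite /I01/= !in_itv/= => /andP[sx xt].
  by rewrite (le_trans s0 sx) (le_trans xt t1).
rewrite Rintegral_itv_obnd_cbnd; last first.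
  by apply: integrableS ifd; [exact: measurable_itv..|exact: subset_itv_oc_cc].
rewrite /Rintegral (@continuous_FTC2 _ fd f)//; first exact: cont01_within.
- have /continuous_within_itvP := cont01_within cf s0 t1 => /(_ st) [_ c1 c2].
  split => // x; rewrite in_itv/= => /andP[sx xt].
  have xx : 0 < x < 1 by rewrite (le_lt_trans s0 sx) (lt_le_trans xt t1).
  by have [] := deriv_on01_is_derive H xx.
- move=> x; rewrite in_itv/= => /andP[sx xt].
  have xx : 0 < x < 1 by rewrite (le_lt_trans s0 sx) (lt_le_trans xt t1).
  by rewrite derive1E; have [] := deriv_on01_is_derive H xx.
Qed.

Lemma deriv_on01M f fd g gd : deriv_on01 f fd -> deriv_on01 g gd ->
  deriv_on01 (fun t => f t * g t) (fun t => fd t * g t + f t * gd t).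
Proof.
move=> Hf Hg t t01; have cg := deriv_on01_cont01 Hg.
move: (Hf _ t01) (Hg _ t01); set F := within _ _ => hf hg.
have FF : Filter F by exact: within_filter.
have gc : g @ F --> g t.
  apply/cvgrPdist_lt => e e0; have [d d0 Hd] := (cont01P g).2 cg _ t01 _ e0.
  exists d => // s /= st [s01 _]; rewrite distrC; apply: Hd => //.
  by rewrite distrC.
have C : (fun s => (f s - f t) / (s - t) * g s + f t * ((g s - g t) / (s - t))) @ F -->
    fd t * g t + f t * gd t.
  by apply: cvgD; [exact: cvgM hf gc|apply: cvgM hg; exact: cvg_cst].
apply: cvg_trans C; apply: near_eq_cvg; near=> s.
have st : s != t by near: s; exists 1 => //= s _ [].
by field; rewrite subr_eq0.
Unshelve. all: by end_near. Qed.

Lemma deriv_on01D f fd g gd : deriv_on01 f fd -> deriv_on01 g gd ->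
  deriv_on01 (fun t => f t + g t) (fun t => fd t + gd t).
Proof.
move=> Hf Hg t t01.
move: (Hf _ t01) (Hg _ t01); set F := within _ _ => hf hg.
have FF : Filter F by exact: within_filter.
have C : (fun s => (f s - f t) / (s - t) + (g s - g t) / (s - t)) @ F --> fd t + gd t.
  exact: cvgD hf hg.
apply: cvg_trans C; apply: near_eq_cvg; near=> s.
have st : s != t by near: s; exists 1 => //= s _ [].
by field; rewrite subr_eq0.
Unshelve. all: by end_near. Qed.

Lemma deriv_on01_cst (c : R) : deriv_on01 (fun=> c) (fun=> 0).
Proof.
move=> t t01; set F := within _ _; have FF : Filter F by exact: within_filter.
under eq_fun do rewrite subrr mul0r.
exact: cvg_cst.
Qed.

Lemma deriv_on01_sum (I : Type) (r : seq I) (F G : I -> R -> R) :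
  (forall i, deriv_on01 (F i) (G i)) ->
  deriv_on01 (fun t => \sum_(i <- r) F i t) (fun t => \sum_(i <- r) G i t).
Proof.
move=> p; elim: r => [|i r IH].
  rewrite (_ : (fun t => _) = (fun=> 0)); last by apply/funext => t; rewrite big_nil.
  rewrite (_ : (fun t => \sum_(i <- [::]) G i t) = (fun=> 0)); first exact: deriv_on01_cst.
  by apply/funext => t; rewrite big_nil.
rewrite (_ : (fun t => _) = (fun t => F i t + \sum_(i <- r) F i t)); last first.
  by apply/funext => t; rewrite big_cons.
rewrite (_ : (fun t => \sum_(i <- i :: r) G i t) = (fun t => G i t + \sum_(i <- r) G i t)).
  exact: deriv_on01D.
by apply/funext => t; rewrite big_cons.
Qed.

Lemma mx_deriv_on01M p q r (F Fd : R -> 'M[R]_(p, q)) (G Gd : R -> 'M[R]_(q, r)) :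
  mx_deriv_on01 F Fd -> mx_deriv_on01 G Gd ->
  mx_deriv_on01 (fun t => F t *m G t) (fun t => Fd t *m G t + F t *m Gd t).
Proof.
move=> HF HG i j.
rewrite (_ : (fun t => _) = (fun t => \sum_k F t i k * G t k j)); last first.
  by apply/funext => t; rewrite mxE.
have -> : (fun t => (Fd t *m G t + F t *m Gd t) i j) =
    (fun t => \sum_k (Fd t i k * G t k j + F t i k * Gd t k j)).
  by apply/funext => t; rewrite !mxE big_split.
by apply: deriv_on01_sum => k; apply: deriv_on01M; [exact: HF|exact: HG].
Qed.

Lemma cont_mxM p q r (F : R -> 'M[R]_(p, q)) (G : R -> 'M[R]_(q, r)) :
  cont_mx F -> cont_mx G -> cont_mx (fun t => F t *m G t).
Proof.
move=> cF cG i j; apply: (@eq_cont01 (fun t => \sum_k F t i k * G t k j)).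
  by move=> t _; rewrite mxE.
by apply: cont01_sum => k; exact: cont01M.
Qed.

Lemma cont_mx_tr p q (F : R -> 'M[R]_(p, q)) : cont_mx F -> cont_mx (fun t => (F t)^T).
Proof. by move=> cF i j; apply: eq_cont01 (cF j i) => t _; rewrite mxE. Qed.

Lemma cont_mxN p q (F : R -> 'M[R]_(p, q)) : cont_mx F -> cont_mx (fun t => - F t).
Proof.
move=> cF i j; apply: (@eq_cont01 (fun t => 0 - F t i j)) => [t _|].
  by rewrite mxE sub0r.
by apply: cont01B; [exact: cont01_cst|exact: cF].
Qed.

Lemma cont01_det p (F : R -> 'M[R]_p) : cont_mx F -> cont01 (fun t => \det (F t)).
Proof.
move=> cF; apply: cont01_sum => s; apply: cont01M; first exact: cont01_cst.
by apply: cont01_prod => i; exact: cF.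
Qed.

(** Cramer's formula: the entries of the inverse are cofactors divided by a determinant that does
    not vanish. *)
Lemma cont_mx_inv p (F : R -> 'M[R]_p) : (forall t, 0 <= t <= 1 -> F t \in unitmx) ->
  cont_mx F -> cont_mx (fun t => invmx (F t)).
Proof.
move=> uF cF i j.
apply: (@eq_cont01 (fun t => (\det (F t))^-1 * ((-1) ^+ (j + i) * \det (row' j (col' i (F t)))))).
  by move=> t /uF u; rewrite /invmx u !mxE.
apply: cont01M.
  apply: cont01V; last exact: cont01_det.
  by move=> t /uF; rewrite unitmxE unitfE.
apply: cont01M; first exact: cont01_cst.
apply: cont01_det => k l; apply: eq_cont01 (cF (lift j k) (lift i l)) => t _.
by rewrite !mxE.
Qed.

Lemma cont_mx_meas p q (F : R -> 'M[R]_(p, q)) : cont_mx F -> meas_mx F.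
Proof. by move=> cF i j; apply: cont01_meas; exact: cF. Qed.

Lemma mx_deriv_on01_cont p q (F Fd : R -> 'M[R]_(p, q)) : mx_deriv_on01 F Fd -> cont_mx F.
Proof. by move=> H i j; exact: deriv_on01_cont01 (H i j). Qed.

Lemma mx_deriv_on01_prim p q (F Fd : R -> 'M[R]_(p, q)) :
  mx_deriv_on01 F Fd -> cont_mx Fd -> prim_mx F Fd.
Proof. by move=> H cFd i j; exact: deriv_on01_prim (H i j) (cFd i j). Qed.

End cont01_theory.

(** * The constraint curves and admissible pairs *)

(* With [V = K *m P] one has [tr (V S0 V^T) + eps tr (K K^T) = qf (cost_form S0 eps P) V]. *)
Definition cost_form {R : realType} (n : nat) (S0 : 'M[R]_n) (eps : R) (P : 'M[R]_n) : 'M[R]_n :=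
  S0 + eps *: (invmx P *m (invmx P)^T).

Section ae_lemmas.
Variable R : realType.
Local Notation mu := (@lebesgue_measure R).

Lemma ae_forall_fin (I : finType) (P : I -> R -> Prop) :
  (forall i, {ae mu, forall x, P i x}) -> {ae mu, forall x, forall i, P i x}.
Proof.
move=> H; have : {ae mu, forall x, forall i, i \in enum I -> P i x}.
  elim: (enum I) => [|i s IH]; first exact: (@filterE _ _ (ae_filter_ringOfSetsType mu)).
  apply: aeS (aeI (H i) IH) => x [Pi Ps] j; rewrite inE => /predU1P[->//|]; exact: Ps.
by apply: aeS => x Hx i; apply: Hx; rewrite mem_enum.
Qed.

Lemma ae_interior : {ae mu, forall t : R, @I01 R t -> 0 < t < 1}.
Proof.
have N (a : R) : {ae mu, forall t, t <> a}.
  exists [set a]; split; [exact: measurable_set1|exact: lebesgue_measure_set1|].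
  by move=> x /= /contrapT.
apply: aeS (aeI (N 0) (N 1)) => t [/eqP t0 /eqP t1]; rewrite /I01/= in_itv/= => /andP[h0 h1].
by rewrite !lt_neqAle h0 h1 t1 eq_sym t0.
Qed.

End ae_lemmas.

Section cost_form_theory.
Variables (R : realType) (n : nat) (S0 : 'M[R]_n) (eps : R).
Hypotheses (pS0 : SymPos S0) (eps0 : 0 < eps).
Local Notation mu := (@lebesgue_measure R).
Local Notation W := (cost_form S0 eps).

Lemma cost_form_tr P : (W P)^T = W P.
Proof. by rewrite /cost_form linearD linearZ/= trmx_mul trmxK pS0.1. Qed.

Lemma qf_cost_form P p (V : 'M[R]_(p, n)) : qf (W P) V = qf S0 V + eps * fro2 (V *m invmx P).
Proof.
rewrite /qf /cost_form mulmxDr mulmxDl linearD/=; congr (_ + _).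
by rewrite -scalemxAr -scalemxAl linearZ/= -mxtrace_fro2 trmx_mul !mulmxA.
Qed.

Lemma qf_cost_form_ge0 P p (V : 'M[R]_(p, n)) : 0 <= qf (W P) V.
Proof. by rewrite qf_cost_form addr_ge0 ?qf_ge0// mulr_ge0 ?fro2_ge0// ltW. Qed.

Lemma fro2_le_qf P p (V : 'M[R]_(p, n)) : eps * fro2 (V *m invmx P) <= qf (W P) V.
Proof. by rewrite qf_cost_form lerDr qf_ge0. Qed.

Lemma meas_mx_qf (V : 'M[R]_n) (F : R -> 'M[R]_n) : meas_mx F -> meas01 (fun t => qf V (F t)).
Proof.
move=> mF; apply: meas_mx_trace; apply: meas_mxM; last exact: meas_mx_tr.
by apply: meas_mxM => //; exact: meas_mx_cst.
Qed.

Lemma meas01_cost (K Phi : R -> 'M[R]_n) : meas_mx K -> meas_mx Phi ->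
  (forall t, 0 <= t <= 1 -> Phi t \in unitmx) ->
  meas01 (fun t => qf (W (Phi t)) (K t *m Phi t)).
Proof.
move=> mK mP uP; apply: (eq_measurable_fun (fun t => qf S0 (K t *m Phi t) + eps * fro2 (K t))).
  by move=> t; rewrite inE /I01/= in_itv/= => /uP u; rewrite qf_cost_form mulmxK.
apply: meas01D; first by apply: meas_mx_qf; exact: meas_mxM.
by apply: meas01M; [exact: meas01_cst|exact: meas_mx_fro2].
Qed.

Lemma cost2'E (K Phi : R -> 'M[R]_n) : meas_mx K -> meas_mx Phi ->
  (forall t, 0 <= t <= 1 -> Phi t \in unitmx) ->
  cost2' eps S0 K Phi =
  ((2^-1)%:E * \int[mu]_(t in @I01 R) (qf (W (Phi t)) (K t *m Phi t))%:E)%E.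
Proof.
move=> mK mP uP; rewrite /cost2' /J_KE /J_A.
have m1 : meas01 (fun t => qf S0 (K t *m Phi t)) by apply: meas_mx_qf; exact: meas_mxM.
have m2 : meas01 (fun t => fro2 (K t)) by exact: meas_mx_fro2.
have -> : (\int[mu]_(t in @I01 R) (\tr (K t *m Phi t *m S0 *m (Phi t)^T *m (K t)^T))%:E =
   \int[mu]_(t in @I01 R) (qf S0 (K t *m Phi t))%:E)%E.
  by apply: eq_integral => t _; rewrite /qf trmx_mul !mulmxA.
have -> : (\int[mu]_(t in @I01 R) (\tr (K t *m (K t)^T))%:E =
   \int[mu]_(t in @I01 R) (fro2 (K t))%:E)%E.
  by apply: eq_integral => t _; rewrite mxtrace_fro2.
have -> : (\int[mu]_(t in @I01 R) (qf (W (Phi t)) (K t *m Phi t))%:E =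
   \int[mu]_(t in @I01 R) ((qf S0 (K t *m Phi t))%:E + eps%:E * (fro2 (K t))%:E))%E.
  apply: eq_integral => t; rewrite inE /I01/= in_itv/= => /uP u.
  by rewrite qf_cost_form mulmxK.
rewrite ge0_integralD//=; first last.
- apply/measurable_EFinP; apply: (@meas01M _ (fun=> eps)) m2; exact: meas01_cst.
- by move=> t _; rewrite lee_fin mulr_ge0 ?fro2_ge0// ltW.
- exact/measurable_EFinP.
- by move=> t _; rewrite lee_fin qf_ge0.
- exact: measurable_I01.
rewrite ge0_integralZl_EFin//=; first last.
- exact: ltW.
- exact/measurable_EFinP.
- by move=> t _; rewrite lee_fin fro2_ge0.
- exact: measurable_I01.
have distr (a b : \bar R) : (0 <= a -> 0 <= b ->
    (2^-1)%:E * a + eps%:E * ((2^-1)%:E * b) = (2^-1)%:E * (a + eps%:E * b))%E.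
  move=> a0 b0; have eb0 : (0 <= eps%:E * b)%E by rewrite mule_ge0// lee_fin ltW.
  by rewrite muleCA ge0_muleDr.
by apply: distr; apply: integral_ge0 => t _; rewrite lee_fin ?qf_ge0 ?fro2_ge0.
Qed.

(** Coercivity: the nonnegative kinetic part is dropped, and the remaining term is [eps] times the
    energy of [K]. *)
Lemma energy_le (K Phi : R -> 'M[R]_n) (c : R) : meas_mx K -> meas_mx Phi ->
  (forall t, 0 <= t <= 1 -> Phi t \in unitmx) ->
  (\int[mu]_(t in @I01 R) (qf (W (Phi t)) (K t *m Phi t))%:E <= c%:E)%E ->
  (\int[mu]_(t in @I01 R) (fro2 (K t))%:E <= (c / eps)%:E)%E.
Proof.
move=> mK mP uP le_c.
have m2 : meas01 (fun t => fro2 (K t)) by exact: meas_mx_fro2.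
have : (eps%:E * \int[mu]_(t in @I01 R) (fro2 (K t))%:E <= c%:E)%E.
  rewrite -ge0_integralZl_EFin//=; first last.
  - exact: ltW.
  - exact/measurable_EFinP.
  - by move=> t _; rewrite lee_fin fro2_ge0.
  - exact: measurable_I01.
  apply: le_trans le_c; apply: ge0_le_integral.
  - exact: measurable_I01.
  - by move=> t _; rewrite lee_fin mulr_ge0 ?fro2_ge0// ltW.
  - by apply/measurable_EFinP; apply: (@meas01M _ (fun=> eps)) m2; exact: meas01_cst.
  - by apply/measurable_EFinP; exact: meas01_cost.
  - move=> t; rewrite /I01/= in_itv/= => /uP u; rewrite lee_fin.
    by have := fro2_le_qf (Phi t) (K t *m Phi t); rewrite mulmxK.
by rewrite [in X in _ -> X]mulrC EFinM lee_pdivlMl.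
Qed.

End cost_form_theory.

(** * The curves $M_t$ and $N_t$ *)

Section constraint_curves.
Variables (R : realType) (n m : nat) (Y Yd : R -> 'M[R]_(n, m)) (N : R -> 'M[R]_(n - m, n)).
Hypothesis C1Y : mx_C1_on01 Y Yd.
Hypothesis rY : forall t, 0 <= t <= 1 -> \rank (Y t) = m.
Local Notation M := (Mcurve Y Yd).
Local Notation mu := (@lebesgue_measure R).

Lemma Mcurve_mulY t : 0 <= t <= 1 -> M t *m Y t = Yd t.
Proof.
move=> t01; rewrite /Mcurve -mulmxA -[Yd t *m _ *m _]mulmxA mulVmx ?mulmx1//.
exact/gram_unitmx/rY.
Qed.

Lemma cont_Y : cont_mx Y. Proof. exact: mx_deriv_on01_cont C1Y.1. Qed.

Lemma cont_Yd : cont_mx Yd. Proof. by move=> i j; exact/within_cont01/C1Y.2. Qed.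

Lemma cont_Mcurve : cont_mx M.
Proof.
have cY := cont_Y; have cYt := cont_mx_tr cY.
apply: cont_mxM => //; apply: cont_mxM; first exact: cont_Yd.
apply: cont_mx_inv; last exact: cont_mxM.
by move=> t t01; exact/gram_unitmx/rY.
Qed.

Hypothesis NY0 : N 0 *m Y 0 = 0.
Hypothesis dN : mx_deriv_on01 N (fun t => - (N t *m M t)).

Lemma cont_N : cont_mx N. Proof. exact: mx_deriv_on01_cont dN. Qed.

(** The derivative of $N_tY_t$ is $-N_tM_tY_t+N_t\dot Y_t$, which vanishes because $M_tY_t=\dot
    Y_t$; so the product keeps its initial value 0. *)
Lemma N_mulY t : 0 <= t <= 1 -> N t *m Y t = 0.
Proof.
move=> /andP[t0 t1]; have D := mx_deriv_on01M dN C1Y.1.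
apply/matrixP => i j.
have p : prim (fun t => (N t *m Y t) i j) (fun=> 0).
  apply: deriv_on01_prim; last exact: cont01_cst.
  move=> s s01.
  have e : (- (N s *m M s) *m Y s + N s *m Yd s) i j = 0.
    by rewrite mulNmx -mulmxA Mcurve_mulY// addNr mxE.
  by have := D i j s s01; rewrite e.
have := p.2 0 t (lexx 0) t0 t1; rewrite NY0 !mxE subr0 => ->.
by rewrite Rintegral_cst ?mul0r//; exact: measurable_itv.
Qed.

Hypothesis mn : (m < n)%N.
Hypothesis rN : \rank (row_mx (Y 0) (N 0)^T) = n.

(** If $vN_t=0$, then $u_s=N_s^\top v^\top$ solves the linear equation $\dot u=-M^\top u$ and
    vanishes at time $t$. The flow bound carries this back to time 0, where the rows are
    independent. *)
Lemma N_row_free t : 0 <= t <= 1 -> row_free (N t).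
Proof.
move=> t01; have fN0 : row_free (N 0) by exact: trailing_row_free (ltnW mn) rN.
pose K t := - (M t)^T.
have cK : cont_mx K by apply: cont_mxN; apply: cont_mx_tr; exact: cont_Mcurve.
have ifK : mu.-integrable (@I01 R) (EFin \o (fun t => fro2 (K t))).
  apply: cont01_integrable; apply: cont01_sum => k.
  by apply: (@cont01M _ (fun t => K t k.1 k.2) (fun t => K t k.1 k.2)); exact: cK.
pose C := fine (\int[mu]_(x in @I01 R) (fro2 (K x))%:E).
have C0 : 0 <= C by apply: fine_ge0; apply: integral_ge0 => x _; rewrite lee_fin fro2_ge0.
have [B HB] := linear_flow_bound n C0.
have pN : prim_mx N (fun t => - (N t *m M t)).
  apply: mx_deriv_on01_prim dN _; apply: cont_mxN; apply: cont_mxM; [exact: cont_N|exact: cont_Mcurve].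
rewrite -kermx_eq0; apply/eqP/row_matrixP => i; rewrite row0; set v := row i _.
have vN : v *m N t = 0 by rewrite /v -row_mul mulmx_ker row0.
have pu : prim_mx (fun t => (N t)^T *m v^T) (fun t => K t *m ((N t)^T *m v^T)).
  rewrite (_ : (fun t => K t *m _) = (fun t => (- (N t *m M t))^T *m v^T)); last first.
    by apply/funext => s; rewrite /K [in RHS]linearN/= (trmx_mul (N s)) !mulNmx mulmxA.
  apply: prim_mx_mulr => k l; rewrite (_ : (fun t => (N t)^T k l) = (fun t => N t l k)).
    rewrite (_ : (fun t => (- (N t *m M t))^T k l) = (fun t => (- (N t *m M t)) l k)).
      exact: pN.
    by apply/funext => s; rewrite mxE.
  by apply/funext => s; rewrite mxE.
have := HB _ K _ (cont_mx_meas cK) _ pu 0 t.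
have vt : (N t)^T *m v^T = 0 by rewrite -trmx_mul vN trmx0.
rewrite lexx ler01 t01 vt nrm1_0 mulr0 => H.
have /nrm1_eq0 : nrm1 ((N 0)^T *m v^T) <= 0.
  apply: H => //; rewrite fineK//; apply: integrable_fin_num => //; exact: measurable_I01.
rewrite -trmx_mul => /(congr1 trmx); rewrite trmxK trmx0 => vN0.
by apply: (row_free_inj fN0); rewrite mul0mx.
Qed.

End constraint_curves.

(** * Consequences of admissibility *)

Section admissible.
Variables (R : realType) (n m : nat) (S0 S1 : 'M[R]_n) (eps : R).
Variables (Y Yd : R -> 'M[R]_(n, m)) (N : R -> 'M[R]_(n - m, n)) (K Phi : R -> 'M[R]_n).
Hypothesis adm : admissible2' eps S0 S1 Y Yd N K Phi.
Local Notation mu := (@lebesgue_measure R).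

Lemma admissible_meas : meas_mx K.
Proof. by move=> i j; case: adm => /(_ i j)[]. Qed.

Lemma admissible_cont : cont_mx Phi.
Proof. by move=> i j; case: adm => _ [ac _]; exact/abs_cont_cont01/ac. Qed.

Lemma admissible_unit t : 0 <= t <= 1 -> Phi t \in unitmx.
Proof. by case: adm => _ [_ [u _]]; exact: u. Qed.

Lemma admissible_init : Phi 0 = 1%:M.
Proof. by case: adm => _ [_ [_ [-> _]]]. Qed.

(** The equation for $\dot\Phi_t$ is available only where all entries are differentiable at once.
    Absolute continuity makes this hold almost everywhere and identifies the densities of the
    entries with those of $K\Phi$. *)
Lemma admissible_prim : prim_mx Phi (fun t => K t *m Phi t).
Proof.
case: adm => _ [ac [_ [_ [dP _]]]].
have /choice[g Hg] : forall p : 'I_n * 'I_n, exists g, prim (fun t => Phi t p.1 p.2) g.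
  by move=> p; exact/abs_cont_prim/ac.
have G : {ae mu, forall t, forall p : 'I_n * 'I_n, 0 < t < 1 ->
    derivable (fun s => Phi s p.1 p.2) t 1 /\ derive1 (fun s => Phi s p.1 p.2) t = g p t}.
  by apply: ae_forall_fin => p; exact: prim_derivable_ae (Hg p).
move=> i j; apply: eq_prim (Hg (i, j)) _ _ _ => //.
  apply: meas_mxM; first exact: admissible_meas.
  by apply: cont_mx_meas; exact: admissible_cont.
apply: aeS (aeI G (ae_interior R)) => t [Ht It] /It t01.
have [_ <-] := Ht (i, j) t01; apply: dP => // k l.
by have [] := Ht (k, l) t01.
Qed.

Hypothesis C1Y : mx_C1_on01 Y Yd.
Hypothesis rY : forall t, 0 <= t <= 1 -> \rank (Y t) = m.
Hypothesis NY0 : N 0 *m Y 0 = 0.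
Hypothesis dN : mx_deriv_on01 N (fun t => - (N t *m Mcurve Y Yd t)).

(** Since $N_tY_t=0$, the constraint on $K$ gives $K_tY_t=\dot Y_t$ almost everywhere. So
    $\Phi_tY_0-Y_t$ solves the homogeneous flow equation with initial value 0 and vanishes. In this
    form the constraint survives pointwise limits. *)
Lemma admissible_mulY (C : R) : 0 <= C ->
  (\int[mu]_(t in @I01 R) (fro2 (K t))%:E <= C%:E)%E ->
  forall t, 0 <= t <= 1 -> Phi t *m Y 0 = Y t.
Proof.
move=> C0 eK t t01; have [B HB] := linear_flow_bound n C0.
have mK := admissible_meas; have cP := admissible_cont.
have cY := cont_Y C1Y.
pose u t := Phi t *m Y 0 - Y t.
have pu0 : prim_mx u (fun t => K t *m Phi t *m Y 0 - Yd t).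
  apply: prim_mxB; first by apply: prim_mx_mulr; exact: admissible_prim.
  apply: mx_deriv_on01_prim C1Y.1 _; exact: cont_Yd C1Y.
have pu : prim_mx u (fun t => K t *m u t).
  move=> i j; apply: eq_prim (pu0 i j) _ _ _ => //.
    apply: meas_mxM => //; apply: meas_mxB; last exact: cont_mx_meas.
    by apply: meas_mxM; [exact: cont_mx_meas|exact: meas_mx_cst].
  case: adm => _ [_ [_ [_ [_ [_ [_ [[Rc [_ KE]] _]]]]]]].
  apply: aeS KE => s Hs Is; have s01 : 0 <= s <= 1 by move: Is; rewrite /I01/= in_itv.
  suff -> : K s *m u s = K s *m Phi s *m Y 0 - Yd s by [].
  rewrite /u mulmxBr mulmxA; congr (_ - _).
  rewrite (Hs Is) mulmxDl Mcurve_mulY// -mulmxA (N_mulY C1Y rY NY0 dN s01).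
  by rewrite mulmx0 addr0.
have := HB _ K u mK eK pu t 0 t01; rewrite lexx ler01 => /(_ isT).
rewrite {2}/u admissible_init mul1mx subrr nrm1_0 mulr0 => /nrm1_eq0/eqP.
by rewrite subr_eq0 => /eqP.
Qed.

End admissible.

(** * Entrywise convergence along a filter *)

Definition cvg_mx {R : realType} (T : Type) (U : set_system T) (p q : nat)
    (F : T -> 'M[R]_(p, q)) (L : 'M[R]_(p, q)) : Prop :=
  forall i j, (fun k => F k i j) @ U --> L i j.

Section cvg_mx_theory.
Variables (R : realType) (T : Type) (U : set_system T).
Context {PF : ProperFilter U}.
Implicit Types p q r : nat.

Lemma cvg_sum_fin (I : Type) (s : seq I) (F : I -> T -> R) (l : I -> R) :
  (forall i, F i @ U --> l i) -> (fun k => \sum_(i <- s) F i k) @ U --> \sum_(i <- s) l i.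
Proof.
move=> H; elim: s => [|i s IH].
  by under eq_fun do rewrite big_nil; rewrite big_nil; exact: cvg_cst.
under eq_fun do rewrite big_cons; rewrite big_cons.
exact: cvgD (H i) IH.
Qed.

Lemma cvg_mx_cst p q (A : 'M[R]_(p, q)) : cvg_mx U (fun=> A) A.
Proof. by move=> i j; exact: cvg_cst. Qed.

Lemma cvg_mxM p q r (F : T -> 'M[R]_(p, q)) (G : T -> 'M[R]_(q, r)) A B :
  cvg_mx U F A -> cvg_mx U G B -> cvg_mx U (fun k => F k *m G k) (A *m B).
Proof.
move=> cF cG i j; under eq_fun do rewrite mxE; rewrite mxE.
by apply: cvg_sum_fin => k; exact: cvgM (cF i k) (cG k j).
Qed.

Lemma cvg_mxD p q (F G : T -> 'M[R]_(p, q)) A B :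
  cvg_mx U F A -> cvg_mx U G B -> cvg_mx U (fun k => F k + G k) (A + B).
Proof.
move=> cF cG i j; under eq_fun do rewrite mxE; rewrite mxE.
exact: cvgD (cF i j) (cG i j).
Qed.

Lemma cvg_mxB p q (F G : T -> 'M[R]_(p, q)) A B :
  cvg_mx U F A -> cvg_mx U G B -> cvg_mx U (fun k => F k - G k) (A - B).
Proof.
move=> cF cG i j; under eq_fun do rewrite !mxE; rewrite !mxE.
exact: cvgB (cF i j) (cG i j).
Qed.

Lemma cvg_mxZ p q (c : R) (F : T -> 'M[R]_(p, q)) A :
  cvg_mx U F A -> cvg_mx U (fun k => c *: F k) (c *: A).
Proof.
move=> cF i j; under eq_fun do rewrite !mxE; rewrite !mxE.
by apply: cvgM (cF i j); exact: cvg_cst.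
Qed.

Lemma cvg_mx_tr p q (F : T -> 'M[R]_(p, q)) A :
  cvg_mx U F A -> cvg_mx U (fun k => (F k)^T) A^T.
Proof. by move=> cF i j; under eq_fun do rewrite !mxE; rewrite !mxE; exact: cF. Qed.

Lemma cvg_mx_trace p (F : T -> 'M[R]_p) A :
  cvg_mx U F A -> (fun k => \tr (F k)) @ U --> \tr A.
Proof. by move=> cF; apply: cvg_sum_fin => i; exact: cF. Qed.

Lemma cvg_mx_unique p q (F : T -> 'M[R]_(p, q)) A B :
  cvg_mx U F A -> cvg_mx U F B -> A = B.
Proof.
move=> cA cB; apply/matrixP => i j.
have h : hausdorff_space R by exact: Rhausdorff.
exact: (@cvg_unique R h ((fun k => F k i j) @ U) _ _ _ (cA i j) (cB i j)).
Qed.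

Lemma cvg_le_cst (f : T -> R) (l c : R) : f @ U --> l -> (\near U, f U <= c) -> l <= c.
Proof. by move=> fl fc; apply: (closed_cvg (fun x => x <= c)) fc _ fl; exact: closed_le. Qed.

Lemma cvg_qf_cost n p (S0 : 'M[R]_n) (eps : R) (P : T -> 'M[R]_n) (V : T -> 'M[R]_(p, n)) P0 V0 :
  cvg_mx U (fun k => invmx (P k)) (invmx P0) -> cvg_mx U V V0 ->
  (fun k => qf (cost_form S0 eps (P k)) (V k)) @ U --> qf (cost_form S0 eps P0) V0.
Proof.
move=> cP cV; apply: cvg_mx_trace; apply: cvg_mxM; last exact: cvg_mx_tr.
apply: cvg_mxM => //; apply: cvg_mxD; first exact: cvg_mx_cst.
by apply: cvg_mxZ; apply: cvg_mxM => //; exact: cvg_mx_tr.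
Qed.

End cvg_mx_theory.

(** Compactness of the segment supplies a cluster point, and an ultrafilter converges to its cluster
    points. One filter thus serves uncountably many times at once, where a diagonal subsequence
    would reach only countably many. *)
Lemma ultra_bounded_cvg (R : realType) (T : Type) (U : set_system T) (x : T -> R) (B : R) :
  UltraFilter U -> (forall k, `|x k| <= B) -> exists l : R, x @ U --> l.
Proof.
move=> UU xB; have := @segment_compact R (- B) B.
move=> /(_ (x @ U) (fmap_proper_filter _ _))[|p [_ clp]].
  by apply: (@filterE _ U) => k; rewrite /= in_itv/= -ler_norml.
exists p => A nA; have [//|nU] := in_ultra_setVsetC (x @^-1` A) UU.
by have [y [/= nAy Ay]] := clp (~` A) A nU nA.
Qed.

(** * Compactness of minimizing sequences *)

Section perturbation.
Variables (R : realType) (n : nat) (S0 : 'M[R]_n) (eps : R).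
Hypotheses (pS0 : SymPos S0) (eps0 : 0 < eps).
Local Notation W := (cost_form S0 eps).

Lemma qf_cost_form_perturb (B e : R) : 0 <= B -> 0 < e -> exists2 d, 0 < d &
  forall P Q : 'M[R]_n, P \in unitmx -> Q \in unitmx -> nrm1 (invmx Q) <= B ->
  nrm1 (P - Q) <= d -> forall V : 'M[R]_n, qf (W Q) V <= (1 + e) * qf (W P) V.
Proof.
(* The factor of [e] in the bound of [fro2_perturb]; the minimum with [e / c] below keeps the total
   excess under [e]. *)
move=> B0 e0; pose c : R := 1 + 2 * n%:R ^+ 2.
have c0 : 0 < c by rewrite ltr_pwDl// mulr_ge0// sqr_ge0.
pose e1 := Num.min 1 (e / c).
have e10 : 0 < e1 by rewrite lt_min ltr01 divr_gt0.
have B10 : 0 < B + 1 by rewrite ltr_wpDl.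
exists (e1 / (B + 1)); first by rewrite divr_gt0.
move=> P Q uP uQ QB PQ V; rewrite !qf_cost_form mulrDr; apply: lerD.
  by rewrite ler_peMl ?qf_ge0// lerDl ltW.
rewrite mulrCA ler_pM2l//.
set Z := V *m invmx P; set E := (P - Q) *m invmx Q.
have -> : V *m invmx Q = Z + Z *m E.
  rewrite /Z /E mulmxBl mulmxV// mulmxBr mulmx1 addrC subrK.
  by rewrite mulmxA mulmxKV.
have Ee : nrm1 E <= e1.
  apply: le_trans (ler_nrm1M _ _) _; apply: (@le_trans _ _ (e1 / (B + 1) * B)).
    by rewrite ler_pM// nrm1_ge0.
  by rewrite -mulrA ler_piMr ?(ltW e10)// ler_pdivrMl// mulr1 lerDl.
apply: le_trans (fro2_perturb Z e10 _ Ee) _; first by rewrite ge_min lexx.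
rewrite ler_wpM2r ?fro2_ge0// lerD2l -ler_pdivlMr//.
by rewrite ge_min lexx orbT.
Qed.

End perturbation.

Section compactness.
Variables (R : realType) (n : nat) (K Phi : nat -> R -> 'M[R]_n) (C : R).
Hypothesis C0 : 0 <= C.
Hypothesis mK : forall k, meas_mx (K k).
Hypothesis uP : forall k t, 0 <= t <= 1 -> Phi k t \in unitmx.
Hypothesis iP : forall k, Phi k 0 = 1%:M.
Hypothesis pP : forall k, prim_mx (Phi k) (fun t => K k t *m Phi k t).
Hypothesis eK : forall k,
  (\int[@lebesgue_measure R]_(t in @I01 R) (fro2 (K k t))%:E <= C%:E)%E.

(** The inverse is bounded by means of the right translate $s\mapsto\Phi_s\Phi_t^{-1}$, which solves
    the same equation, equals the identity at $s=t$ and equals $\Phi_t^{-1}$ at $s=0$. *)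
Lemma flow_bounds : exists2 B : R, 0 <= B & forall k t, 0 <= t <= 1 ->
  nrm1 (Phi k t) <= B /\ nrm1 (invmx (Phi k t)) <= B.
Proof.
have [N HN] := linear_flow_bound n C0.
exists (2 ^+ N * nrm1 (1%:M : 'M[R]_n)).
  by rewrite mulr_ge0 ?exprn_ge0// nrm1_ge0.
move=> k t t01; have z01 : 0 <= (0 : R) <= 1 by rewrite lexx ler01.
split; first by rewrite -(iP k); exact: HN (mK k) (eK k) (pP k) _ _ _ _.
have := HN _ (K k) (fun s => Phi k s *m invmx (Phi k t)) (mK k) (eK k) _ 0 t z01 t01.
rewrite iP mul1mx mulmxV ?uP//; apply.
have := prim_mx_mulr (invmx (Phi k t)) (pP k).
by rewrite (_ : (fun s => K k s *m Phi k s *m _) = (fun s => K k s *m (Phi k s *m invmx (Phi k t)))) //;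
  apply/funext => s; rewrite mulmxA.
Qed.

Lemma flow_equi_abs_cont (e : R) : 0 < e -> exists2 d, 0 < d &
  forall l, itv_family 0 1 l -> \sum_(x <- l) (x.2 - x.1) < d ->
  forall k, \sum_(x <- l) nrm1 (Phi k x.2 - Phi k x.1) <= e.
Proof.
move=> e0; have [B B0 HB] := flow_bounds.
pose B1 := B + 1; have B10 : 0 < B1 by rewrite ltr_wpDl.
have C10 : 0 < C + 1 by rewrite ltr_wpDl.
(* The weight in Young's inequality is chosen so that the energy term is at most [e / 2] after
   multiplication by [B1]; the length bound below does the same for the other term. The added ones
   keep all denominators positive. *)
pose c := e / (2 * B1 * (C + 1)).
have c0 : 0 < c by rewrite divr_gt0// !mulr_gt0.
pose D : R := (n * n)%:R / c + 1.
have D0 : 0 < D by rewrite ltr_wpDl// divr_ge0// ltW.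
exists (e / (2 * B1 * D)); first by rewrite divr_gt0// !mulr_gt0.
move=> l fam lt_d k.
rewrite -lee_fin -sumEFin.
have mKk := mK k; have mN := meas_mx_nrm1 mKk.
apply: (@le_trans _ _ (B1%:E * \sum_(x <- l) int01 x.1 x.2 (fun y => nrm1 (K k y)))%E).
  rewrite ge0_sume_distrr; last by move=> x _; apply: int01_ge0 => y; exact: nrm1_ge0.
  rewrite big_seq [leRHS]big_seq; apply: lee_sum => x xl.
  have /andP[al _] := fam; have /andP[/andP[x0 x12] x1] := allP al _ xl.
  apply: le_trans (prim_mx_nrm1_le (pP k) x0 x12 x1) _.
  rewrite -int01Z//; [|by move=> y; exact: nrm1_ge0|exact: ltW].
  apply: le_int01 => //; first by apply: meas_mx_nrm1; exact: prim_mx_meas (pP k).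
    by apply: meas01M => //; exact: meas01_cst.
  move=> y /andP[xy yx]; split; first exact: nrm1_ge0.
  apply: le_trans (ler_nrm1M _ _) _; rewrite mulrC ler_wpM2r ?nrm1_ge0//.
  have [|h _] := HB k y; first by rewrite (ltW (le_lt_trans x0 xy)) (le_trans yx x1).
  by rewrite (le_trans h)// lerDl.
apply: le_trans (lee_wpmul2l _ (family_nrm1_le mKk (eK k) c0 fam)) _.
  by rewrite lee_fin ltW.
rewrite -EFinM lee_fin.
have h1 : B1 * (c * C) <= e / 2.
  have -> : B1 * (c * C) = e / 2 * (C / (C + 1)) by rewrite /c; field; rewrite !gt_eqF.
  by rewrite ler_piMr ?divr_ge0 ?(ltW e0)// ler_pdivrMr// mul1r lerDl.
have h2 : B1 * ((n * n)%:R / c * \sum_(x <- l) (x.2 - x.1)) <= e / 2.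
  apply: (@le_trans _ _ (B1 * (D * (e / (2 * B1 * D))))); last first.
    rewrite le_eqVlt; apply/orP; left; apply/eqP; field.
    by rewrite !gt_eqF.
  rewrite ler_pM2l// ler_pM//.
  - by rewrite divr_ge0// ltW.
  - rewrite big_seq sumr_ge0// => x xl; rewrite subr_ge0.
    by have /andP[al _] := fam; have /andP[/andP[]] := allP al _ xl.
  - by rewrite lerDl.
  - exact: ltW.
rewrite mulrDr [leRHS]splitr; exact: lerD.
Qed.

(** The matrices and their inverses are passed to the limit together, so the two limits multiply to
    the identity and invertibility is preserved. Limits are taken at clamped times, which makes
    [Phis] constant on either side of the unit interval. *)
Lemma flow_limit : exists Phis : R -> 'M[R]_n, exists2 U : set_system nat,
  (UltraFilter U /\ forall k0, U [set k | (k0 <= k)%N]) &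
  [/\ forall t, Phis t = Phis (clamp01 t),
      forall t, 0 <= t <= 1 -> Phis t \in unitmx,
      forall t, 0 <= t <= 1 -> cvg_mx U (fun k => Phi k t) (Phis t) &
      forall t, 0 <= t <= 1 -> cvg_mx U (fun k => invmx (Phi k t)) (invmx (Phis t))].
Proof.
have [B B0 HB] := flow_bounds.
have [U [UU ooU]] := ultraFilterLemma (_ : ProperFilter (\oo : set_system nat)).
have [P HP] : exists P : R -> 'M[R]_n, forall t, cvg_mx U (fun k => Phi k (clamp01 t)) (P t).
  have /choice[P HP] : forall t, exists A : 'M[R]_n, cvg_mx U (fun k => Phi k (clamp01 t)) A.
    move=> t; have /choice[l Hl] : forall p : 'I_n * 'I_n,
        exists l : R, (fun k => Phi k (clamp01 t) p.1 p.2) @ U --> l.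
      move=> p; apply: (@ultra_bounded_cvg _ _ _ _ B) => k.
      by have [h _] := HB k _ (clamp01_in t); exact: le_trans (le_nrm1 _ _ _) h.
    by exists (\matrix_(i, j) l (i, j)) => i j; rewrite mxE; exact: Hl (i, j).
  by exists P.
have [Q HQ] : exists Q : R -> 'M[R]_n, forall t, cvg_mx U (fun k => invmx (Phi k (clamp01 t))) (Q t).
  have /choice[P' HP'] : forall t, exists A : 'M[R]_n, cvg_mx U (fun k => invmx (Phi k (clamp01 t))) A.
    move=> t; have /choice[l Hl] : forall p : 'I_n * 'I_n,
        exists l : R, (fun k => invmx (Phi k (clamp01 t)) p.1 p.2) @ U --> l.
      move=> p; apply: (@ultra_bounded_cvg _ _ _ _ B) => k.
      by have [_ h] := HB k _ (clamp01_in t); exact: le_trans (le_nrm1 _ _ _) h.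
    by exists (\matrix_(i, j) l (i, j)) => i j; rewrite mxE; exact: Hl (i, j).
  by exists P'.
have clK t : clamp01 (clamp01 t) = clamp01 t :> R.
  by rewrite clamp01E ?clamp01_ge0 ?clamp01_le1.
have PQ t : P t *m Q t = 1%:M.
  apply: (@cvg_mx_unique _ _ U _ _ _ (fun k => Phi k (clamp01 t) *m invmx (Phi k (clamp01 t)))).
    exact: cvg_mxM.
  rewrite (_ : (fun k => _) = fun=> 1%:M); first exact: cvg_mx_cst.
  by apply/funext => k; rewrite mulmxV// uP// clamp01_in.
have uP' t : P t \in unitmx by have [] := mulmx1_unit (PQ t).
have QE t : Q t = invmx (P t) by rewrite -[Q t]mul1mx -(mulVmx (uP' t)) -mulmxA PQ mulmx1.
exists P, U; first split => //.
  by move=> k0; apply: ooU; exists k0.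
split => //.
- by move=> t; apply: (@cvg_mx_unique _ _ U _ _ _ (fun k => Phi k (clamp01 t))) => //; have := HP (clamp01 t); rewrite clK.
- by move=> t /andP[t0 t1]; have := HP t; rewrite clamp01E.
- by move=> t /andP[t0 t1]; have := HQ t; rewrite clamp01E// QE.
Qed.

End compactness.

(** * Lower semicontinuity of the cost *)

Section difference_quotients.
Variable R : realType.
Implicit Types (f : R -> R) (t : R).

Lemma derivable_eps f t : derivable f t 1 -> forall e, 0 < e -> exists2 d, 0 < d &
  forall s, `|s - t| < d -> `|f s - f t - derive1 f t * (s - t)| <= e * `|s - t|.
Proof.
move=> df e e0; have C : (fun h : R => h^-1 *: ((f \o shift t) (h *: (1 : R)) - f t)) @ 0^'
    --> derive1 f t by rewrite derive1E; exact: df.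
move/cvgrPdist_lt : C => /(_ _ e0) [d d0 Hd]; exists d => // s sd.
have [->|st] := eqVneq s t; first by rewrite !subrr mulr0 subrr !normr0 mulr0.
have st0 : s - t != 0 by rewrite subr_eq0.
have := Hd (s - t); rewrite /= sub0r normrN => /(_ sd st0).
rewrite /shift/= scaler1 subrK => /ltW H.
have -> : f s - f t - derive1 f t * (s - t) =
    ((s - t)^-1 *: (f s - f t) - derive1 f t) * (s - t).
  by rewrite mulrBl [_ *: _]mulrC mulfVK.
by rewrite normrM ler_wpM2r// distrC.
Qed.

(** The intervals contain [t] but need not start there, as is the case for grid cells. The errors at
    the two ends add up to at most [e * (b k - a k)], hence to [e] after division by the length. *)
Lemma straddle_cvg f t (a b : nat -> R) : derivable f t 1 ->
  (forall k, a k <= t <= b k) -> (forall k, b k - a k = k.+1%:R^-1) ->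
  (fun k => k.+1%:R * (f (b k) - f (a k))) @ \oo --> derive1 f t.
Proof.
move=> df ab len; apply/cvgrPdist_le => e e0.
have [d d0 Hd] := derivable_eps df e0.
have [J _ HJ] := near_infty_natSinv_lt (PosNum d0).
exists J => // k /= Jk.
have /andP[akt tbk] := ab k; have kd := HJ _ Jk; rewrite /= -len in kd.
have h1 : `|f (b k) - f t - derive1 f t * (b k - t)| <= e * (b k - t).
  have := Hd (b k); rewrite ger0_norm ?subr_ge0//; apply; lra.
have h2 : `|f (a k) - f t - derive1 f t * (a k - t)| <= e * (t - a k).
  have := Hd (a k); rewrite distrC ger0_norm ?subr_ge0//; apply; lra.
have k0 : 0 < k.+1%:R :> R by [].
have -> : derive1 f t - k.+1%:R * (f (b k) - f (a k)) = - (k.+1%:R *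
    ((f (b k) - f t - derive1 f t * (b k - t)) - (f (a k) - f t - derive1 f t * (a k - t)))).
  have -> : (f (b k) - f t - derive1 f t * (b k - t)) - (f (a k) - f t - derive1 f t * (a k - t))
     = (f (b k) - f (a k)) - derive1 f t * (b k - a k) by ring.
  by rewrite len; set q := k.+1%:R in k0 *; field; rewrite gt_eqF.
rewrite normrN normrM (ger0_norm (ltW k0)) mulrC -ler_pdivlMr//.
apply: le_trans (ler_normB _ _) _; apply: le_trans (lerD h1 h2) _.
by rewrite -mulrDr addrA subrK len.
Qed.

End difference_quotients.

(* A Borel function defined everywhere that agrees with the derivative wherever the latter exists:
   the admissibility constraint on [K] concerns every point of differentiability. *)
Definition upper_deriv {R : realType} (f : R -> R) (t : R) : R :=
  fine (limn_esup (fun k => (k.+1%:R * (f (t + k.+1%:R^-1) - f t))%:E)).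

Section upper_derivative.
Variable R : realType.
Implicit Types (f : R -> R) (t : R).

Lemma upper_derivE f t : derivable f t 1 -> upper_deriv f t = derive1 f t.
Proof.
move=> df; have C := @straddle_cvg R f t (fun=> t) (fun k => t + k.+1%:R^-1) df.
have H : (fun k => k.+1%:R * (f (t + k.+1%:R^-1) - f t)) @ \oo --> derive1 f t.
  apply: C => k; first by rewrite lexx/= lerDl invr_ge0.
  by rewrite addrAC subrr add0r.
have E : (fun k => (k.+1%:R * (f (t + k.+1%:R^-1) - f t))%:E) @ \oo --> (derive1 f t)%:E.
  by apply: cvg_EFin => //; near=> k.
by rewrite /upper_deriv (cvg_limn_einf_sup E).2.
Unshelve. all: by end_near. Qed.

Lemma upper_deriv_meas f : continuous f -> meas01 (upper_deriv f).
Proof.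
move=> cf; have mf : measurable_fun setT f by exact: continuous_measurable_fun.
apply: measurable_funTS; apply: measurableT_comp; first exact: fine_measurable.
apply: measurable_fun_limn_esup => k; apply/measurable_EFinP.
apply: measurable_funM; first exact: measurable_cst.
apply: measurable_funB => //; apply: measurableT_comp => //.
by apply: measurable_funD => //; exact: measurable_cst.
Qed.

End upper_derivative.

(** * Discretized costs and their limits *)

Section semicontinuity.
Variables (R : realType) (n : nat) (S0 : 'M[R]_n) (eps : R).
Hypotheses (pS0 : SymPos S0) (eps0 : 0 < eps).
Variables (K Phi : nat -> R -> 'M[R]_n) (C c : R).
Hypothesis C0 : 0 <= C.
Hypothesis c0 : 0 <= c.
Hypothesis mK : forall k, meas_mx (K k).
Hypothesis cP : forall k, cont_mx (Phi k).
Hypothesis uP : forall k t, 0 <= t <= 1 -> Phi k t \in unitmx.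
Hypothesis iP : forall k, Phi k 0 = 1%:M.
Hypothesis pP : forall k, prim_mx (Phi k) (fun t => K k t *m Phi k t).
Local Notation mu := (@lebesgue_measure R).
Local Notation W := (cost_form S0 eps).
Hypothesis eK : forall k, (\int[mu]_(t in @I01 R) (fro2 (K k t))%:E <= C%:E)%E.
Hypothesis costK : forall e, 0 < e -> exists k0, forall k, (k0 <= k)%N ->
  (\int[mu]_(t in @I01 R) (qf (W (Phi k t)) (K k t *m Phi k t))%:E <= (c + e)%:E)%E.

(** Only two nodes enter, so this quantity follows pointwise convergence of [P] and of its inverse
    at those nodes. *)
Definition grid_cost (P : R -> 'M[R]_n) (j i : nat) : R :=
  qf (W (P (i%:R / j.+1%:R)))
     (j.+1%:R *: (P (i.+1%:R / j.+1%:R) - P (i%:R / j.+1%:R))).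

Lemma grid_cost_ge0 P j i : 0 <= grid_cost P j i.
Proof. exact: qf_cost_form_ge0. Qed.

Lemma cell_itv_family j (r : seq nat) : (forall i, i \in r -> (i < j.+1)%N) -> sorted ltn r ->
  itv_family (0 : R) 1 [seq (i%:R / j.+1%:R, i.+1%:R / j.+1%:R) | i <- r].
Proof.
move=> rj sr; apply/andP; split.
  by apply/allP => x /mapP[i /rj ij ->]; rewrite /= cell_ge0 cell_le cell_le1.
rewrite pairwise_map; apply: (@sub_pairwise _ ltn).
  by move=> i k /= ik; rewrite ler_pM2r ?invr_gt0// ler_nat ik.
by rewrite -sorted_pairwise//; exact: ltn_trans.
Qed.

Lemma grid_cost_le (e : R) : 0 < e -> exists J, forall j, (J <= j)%N -> forall k,
  ((\sum_(i < j.+1) j.+1%:R^-1 * grid_cost (Phi k) j i)%:E <= (1 + e)%:E *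
   \int[mu]_(t in @I01 R) (qf (W (Phi k t)) (K k t *m Phi k t))%:E)%E.
Proof.
move=> e0; have [B B0 HB] := flow_bounds C0 mK uP iP pP eK.
(* A chain of choices, none depending on [k]: [d] is the distance of matrices that changes the form
   by at most the factor [1 + e], [d'] a time lapse within which no flow moves further than [d], and
   [J] a grid with mesh below [d']. *)
have [d d0 Hd] := qf_cost_form_perturb pS0 eps0 B0 e0.
have [d' d'0 Hd'] := flow_equi_abs_cont C0 mK uP iP pP eK d0.
have [J _ HJ] := near_infty_natSinv_lt (PosNum d'0).
exists J => j Jj k; have jd' := HJ _ Jj; rewrite /= in jd'.
have cPk : cont_mx (Phi k) by exact: cP.
have mq := meas01_cost S0 eps (mK k) (cont_mx_meas cPk) (uP k).
have q0 t : 0 <= qf (W (Phi k t)) (K k t *m Phi k t) by exact: qf_cost_form_ge0.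
have fam := @cell_itv_family j (iota 0 j.+1) _ (iota_ltn_sorted _ _).
have := family_int01_le mq q0 (fam _); rewrite big_map => H.
apply: (@le_trans _ _ ((1 + e)%:E * \sum_(i <- iota 0 j.+1)
    int01 (i%:R / j.+1%:R) (i.+1%:R / j.+1%:R)
      (fun t => qf (W (Phi k t)) (K k t *m Phi k t)))%E); last first.
  rewrite lee_wpmul2l ?lee_fin ?addr_ge0// ?(ltW e0)//; apply: H.
  by move=> i; rewrite mem_iota add0n => /andP[].
rewrite -(big_mkord xpredT (fun i => j.+1%:R^-1 * grid_cost (Phi k) j i)).
rewrite /index_iota subn0 -sumEFin ge0_sume_distrr; last by move=> i _; exact: int01_ge0.
rewrite big_seq [leRHS]big_seq; apply: lee_sum => i; rewrite mem_iota add0n => /andP[_ ij].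
set a := i%:R / j.+1%:R; set b := i.+1%:R / j.+1%:R.
have a0 : 0 <= a by exact: cell_ge0.
have ba : b - a = j.+1%:R^-1 by exact: cell_length.
have ab : a < b by rewrite -subr_gt0 ba invr_gt0.
have b1 : b <= 1 by exact: cell_le1.
have a01 : 0 <= a <= 1 by rewrite a0 (le_trans (ltW ab) b1).
rewrite -int01Z//; last by rewrite addr_ge0// ltW.
have := qf_jensen (cost_form_tr eps pS0 (Phi k a)) (qf_cost_form_ge0 pS0 eps0 (Phi k a) (p:=n))
  (pP k) a0 ab b1.
rewrite ba invrK => /le_trans; apply; apply: le_int01 => //.
- by apply: meas_mx_qf; exact: prim_mx_meas (pP k).
- by apply: meas01M => //; exact: meas01_cst.
move=> x /andP[ax xb]; split; first exact: qf_cost_form_ge0.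
have x01 : 0 <= x <= 1 by rewrite (ltW (le_lt_trans a0 ax)) (le_trans xb b1).
have [_ QB] := HB k _ a01.
apply: (Hd _ _ (uP k x01) (uP k a01) QB).
have := Hd' [:: (a, x)] _ _ k; rewrite !big_seq1/=; apply.
  by rewrite /itv_family/= a0 (ltW ax) (le_trans xb b1).
by apply: le_lt_trans jd'; rewrite -ba lerD2r.
Qed.

Variables (Phis : R -> 'M[R]_n) (U : set_system nat).
Context {UU : UltraFilter U}.
Hypothesis Utail : forall k0, U [set k | (k0 <= k)%N].
Hypothesis clampP : forall t, Phis t = Phis (clamp01 t).
Hypothesis uPs : forall t, 0 <= t <= 1 -> Phis t \in unitmx.
Hypothesis cvP : forall t, 0 <= t <= 1 -> cvg_mx U (fun k => Phi k t) (Phis t).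
Hypothesis cvV : forall t, 0 <= t <= 1 -> cvg_mx U (fun k => invmx (Phi k t)) (invmx (Phis t)).

Lemma limit_abs_cont : mx_abs_cont_on01 Phis.
Proof.
move=> i j e e0; have e20 : 0 < e / 2 by rewrite divr_gt0.
have [d d0 Hd] := flow_equi_abs_cont C0 mK uP iP pP eK e20.
exists d => // s al pw lt_d; have fam : itv_family 0 1 s by rewrite /itv_family al pw.
apply: (@le_lt_trans _ _ (e / 2)); last by rewrite ltr_pdivrMr// ltr_pMr// ltr1n.
(* [cvg_sum_fin] requires convergence for every pair of times, whereas the flows converge only on
   the unit interval. The times are therefore clamped, which leaves the family itself unchanged. *)
have cv : (fun k => \sum_(x <- [seq (clamp01 x.1, clamp01 x.2) | x <- s])
    `|Phi k x.2 i j - Phi k x.1 i j|) @ U -->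
    \sum_(x <- [seq (clamp01 x.1, clamp01 x.2) | x <- s]) `|Phis x.2 i j - Phis x.1 i j|.
  rewrite big_map; under eq_fun do rewrite big_map.
  apply: cvg_sum_fin => x; apply: cvg_norm.
  by apply: cvgB; [exact: (cvP (clamp01_in x.2))|exact: (cvP (clamp01_in x.1))].
have sE : [seq (clamp01 x.1, clamp01 x.2) | x <- s] = s.
  rewrite -[RHS]map_id; apply/eq_in_map => x /(allP al) /andP[/andP[x0 x12] x1].
  by rewrite !clamp01E ?(le_trans x0)// ?(le_trans x12)//; case: x {x0 x12 x1}.
rewrite sE in cv; apply: (cvg_le_cst cv); apply: filterE => k.
apply: le_trans (Hd s fam lt_d k); apply: ler_sum => x _.
by have := le_nrm1 (Phi k x.2 - Phi k x.1) i j; rewrite !mxE.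
Qed.

Lemma limit_grid_cost_le (e : R) : 0 < e -> exists J, forall j, (J <= j)%N ->
  \sum_(i < j.+1) j.+1%:R^-1 * grid_cost Phis j i <= c + e.
Proof.
move=> e0; have e20 : 0 < e / 2 by rewrite divr_gt0.
pose D := c + e / 2; have D0 : 0 < D by rewrite ltr_wpDl.
(* The relative error is chosen so that $(1+e/(2D))D=D+e/2=c+e$. *)
have eD0 : 0 < e / 2 / D by rewrite divr_gt0.
have [J HJ] := grid_cost_le eD0; have [k0 Hk0] := costK e20.
exists J => j Jj.
have cv : (fun k => \sum_(i < j.+1) j.+1%:R^-1 * grid_cost (Phi k) j i) @ U -->
    \sum_(i < j.+1) j.+1%:R^-1 * grid_cost Phis j i.
  apply: cvg_sum_fin => i; apply: cvgM; first exact: cvg_cst.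
  have b01 : 0 <= (i.+1%:R / j.+1%:R : R) <= 1 by rewrite cell_ge0 cell_le1.
  have a01 : 0 <= (i%:R / j.+1%:R : R) <= 1.
    by rewrite cell_ge0 (le_trans (cell_le _ _ _))// cell_le1.
  apply: cvg_qf_cost; first exact: cvV.
  by apply: cvg_mxZ; apply: cvg_mxB; exact: cvP.
apply: (cvg_le_cst cv); apply: filterS (Utail k0) => k /= kk0.
rewrite -lee_fin; apply: le_trans (HJ _ Jj k) _.
apply: le_trans (lee_wpmul2l _ (Hk0 _ kk0)) _; first by rewrite lee_fin addr_ge0// ltW.
rewrite -EFinM lee_fin -/D mulrDl mul1r mulfVK ?gt_eqF// /D -addrA -splitr.
exact: lexx.
Qed.

(** A step function whose integral is the discrete cost, so that Fatou's lemma applies to the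
    refinement of grids. *)
Definition grid_step (j : nat) (t : R) : R := \sum_(i < j.+1) grid_cost Phis j i * \1_(cell j i) t.

Lemma grid_step_ge0 j t : 0 <= grid_step j t.
Proof. by apply: sumr_ge0 => i _; rewrite mulr_ge0// grid_cost_ge0. Qed.

Lemma grid_stepE j i t : (i < j.+1)%N -> cell j i t -> grid_step j t = grid_cost Phis j i.
Proof.
move=> ij it; rewrite /grid_step (bigD1 (Ordinal ij))//= indicE mem_set// mulr1.
rewrite big1 ?addr0// => k ki; rewrite indicE memNset ?mulr0// => kt.
have /trivIsetP /(_ i k I I) H := @trivIset_cell R j.
have : (cell j i `&` cell j k) t by [].
by rewrite H// eq_sym; apply: contra ki => /eqP ki; apply/eqP/val_inj.
Qed.

Lemma meas01_indic_cell j i : meas01 (\1_(cell j i) : R -> R).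
Proof. by apply: measurable_indic; exact: measurable_cell. Qed.

Lemma grid_step_meas j : meas01 (grid_step j).
Proof.
by apply: meas01_sum => i; apply: meas01M; [exact: meas01_cst|exact: meas01_indic_cell].
Qed.

Lemma integral_grid_step j : (\int[mu]_(t in @I01 R) (grid_step j t)%:E =
  (\sum_(i < j.+1) j.+1%:R^-1 * grid_cost Phis j i)%:E)%E.
Proof.
have -> : (\int[mu]_(t in @I01 R) (grid_step j t)%:E =
   \int[mu]_(t in @I01 R) (\sum_(i < j.+1) (grid_cost Phis j i * \1_(cell j i) t)%:E))%E.
  by apply: eq_integral => t _; rewrite sumEFin.
rewrite ge0_integral_sum; first last.
- by move=> i t _; rewrite lee_fin mulr_ge0// grid_cost_ge0.
- move=> i; apply/measurable_EFinP.
  by apply: (@meas01M _ (fun=> _)); [exact: meas01_cst|exact: meas01_indic_cell].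
- exact: measurable_I01.
rewrite -sumEFin; apply: eq_bigr => i _.
under eq_integral do rewrite EFinM.
rewrite ge0_integralZl_EFin; first last.
- exact: grid_cost_ge0.
- by apply/measurable_EFinP; exact: meas01_indic_cell.
- by move=> t _; rewrite lee_fin.
- exact: measurable_I01.
rewrite integral_indic; [|exact: measurable_I01|exact: measurable_cell].
rewrite setIidl.
  by rewrite [in RHS]mulrC EFinM; congr (_ * _)%E; exact: lebesgue_measure_cell.
by apply: I01_itv; [exact: cell_ge0|exact: cell_le1].
Qed.

Definition limit_deriv (t : R) : 'M[R]_n := \matrix_(i, j) upper_deriv (fun s => Phis s i j) t.

Lemma limit_cont : cont_mx Phis.
Proof. by move=> i j; apply: abs_cont_cont01; exact: limit_abs_cont. Qed.

Lemma limit_deriv_meas : meas_mx limit_deriv.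
Proof.
move=> i j; have cf : continuous (fun s => Phis s i j).
  have := limit_cont (i := i) (j := j); rewrite /cont01.
  by rewrite (_ : _ \o _ = (fun s => Phis s i j))//; apply/funext => t /=; rewrite -clampP.
by have := upper_deriv_meas cf; apply: eq_measurable_fun => t _; rewrite mxE.
Qed.

Lemma grid_step_cvg t : 0 < t < 1 -> (forall i j, derivable (fun s => Phis s i j) t 1) ->
  (fun j => grid_step j t) @ \oo --> qf (W (Phis t)) (limit_deriv t).
Proof.
move=> /andP[t0 t1] dP.
have /choice[r Hr] : forall j, exists i, (i < j.+1)%N /\ cell j i t.
  by move=> j; have [i ij it] := cell_cover j t0 (ltW t1); exists i.
pose a j : R := (r j)%:R / j.+1%:R; pose b j : R := (r j).+1%:R / j.+1%:R.
have ab j : a j <= t <= b j.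
  have [_] := Hr j; rewrite /cell/= in_itv/= => /andP[/ltW h1 h2].
  by rewrite h1 h2.
have a01 j : 0 <= a j <= 1.
  by have /andP[h _] := ab j; rewrite cell_ge0 (le_trans h (ltW t1)).
have len j : b j - a j = j.+1%:R^-1 by exact: cell_length.
have -> : (fun j => grid_step j t) =
    (fun j => qf (W (Phis (a j))) (j.+1%:R *: (Phis (b j) - Phis (a j)))).
  by apply/funext => j; have [ij it] := Hr j; rewrite (grid_stepE ij it).
have at_ : a @ \oo --> t.
  apply/cvgrPdist_lt => e e0; have [J _ HJ] := near_infty_natSinv_lt (PosNum e0).
  exists J => // j /= Jj; apply: le_lt_trans (HJ _ Jj) => /=; rewrite -len.
  by have /andP[h1 h2] := ab j; rewrite ger0_norm ?subr_ge0// lerD2r.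
apply: cvg_qf_cost.
  have cV : cont_mx (fun t => invmx (Phis t)) by apply: cont_mx_inv => //; exact: limit_cont.
  move=> i j; have H := cV i j t.
  have := cvg_comp _ _ at_ H; rewrite /= clamp01E ?ltW//.
  rewrite (_ : _ \o _ = (fun k => invmx (Phis (a k)) i j))//.
  by apply/funext => k /=; have /andP[h1 h2] := a01 k; rewrite clamp01E.
move=> i j; rewrite mxE upper_derivE//.
have := straddle_cvg (dP i j) ab len.
by under [in X in _ -> X]eq_fun do rewrite !mxE.
Qed.

Lemma limit_cost_le :
  (\int[mu]_(t in @I01 R) (qf (W (Phis t)) (limit_deriv t))%:E <= c%:E)%E.
Proof.
have mq : meas01 (fun t => qf (W (Phis t)) (limit_deriv t)).
  have mV : meas_mx (fun t => limit_deriv t *m invmx (Phis t)).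
    apply: meas_mxM; first exact: limit_deriv_meas.
    by apply: cont_mx_meas; apply: cont_mx_inv => //; exact: limit_cont.
  have := meas01_cost S0 eps mV (cont_mx_meas limit_cont) uPs.
  apply: eq_measurable_fun => t; rewrite inE /I01/= in_itv/= => /uPs u.
  by rewrite mulmxKV.
have ae : {ae mu, forall t, @I01 R t -> (qf (W (Phis t)) (limit_deriv t))%:E =
    limn_einf (fun j => (grid_step j t)%:E)}.
  have : {ae mu, forall t, forall p : 'I_n * 'I_n, 0 < t < 1 ->
      derivable (fun s => Phis s p.1 p.2) t 1}.
    apply: ae_forall_fin => p; have [g Hg] := abs_cont_prim (limit_abs_cont p.1 p.2).
    by apply: aeS (prim_derivable_ae Hg) => t H /H[].
  move=> D; apply: aeS (aeI D (ae_interior R)) => t [Dt It] /It t01.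
  have H := grid_step_cvg t01 (fun i j => Dt (i, j) t01).
  have E : (fun j => (grid_step j t)%:E) @ \oo --> (qf (W (Phis t)) (limit_deriv t))%:E.
    by apply: cvg_EFin => //; near=> k.
  by rewrite (cvg_limn_einf_sup E).1.
have -> : (\int[mu]_(t in @I01 R) (qf (W (Phis t)) (limit_deriv t))%:E =
    \int[mu]_(t in @I01 R) limn_einf (fun j => (grid_step j t)%:E))%E.
  apply: ae_eq_integral => //.
  - exact: measurable_I01.
  - exact/measurable_EFinP.
  - have -> : (fun t => limn_einf (fun j => (grid_step j t)%:E)) =
        (fun t => - limn_esup (fun j => - (grid_step j t)%:E))%E.
      by apply/funext => t; rewrite -[LHS]oppeK -limn_esupN.
    apply: measurableT_comp; first exact: oppe_measurable.
    apply: measurable_fun_limn_esup => j; apply: measurableT_comp; first exact: oppe_measurable.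
    by apply/measurable_EFinP; exact: grid_step_meas.
apply: le_trans (fatou _ _ _ _) _.
- exact: measurable_I01.
- by move=> j; apply/measurable_EFinP; exact: grid_step_meas.
- by move=> j t _; rewrite lee_fin grid_step_ge0.
apply/lee_addgt0Pr => e e0; have [J HJ] := limit_grid_cost_le e0.
rewrite limn_einf_lim; apply: lime_le; first exact: is_cvg_einfs.
(* The index [maxn k J] is late enough for the infimum over the tail from [k] and for the cost bound
   from [J] on. *)
near=> k; apply: (@le_trans _ _ (\int[mu]_(t in @I01 R) (grid_step (maxn k J) t)%:E)%E).
  by apply: ereal_inf_lbound; exists (maxn k J) => //=; exact: leq_maxl.
by rewrite integral_grid_step -EFinD lee_fin HJ// leq_maxr.
Unshelve. all: by end_near. Qed.

End semicontinuity.

(** * Existence of minimizers *)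

Section square_integrability.
Variable R : realType.
Local Notation mu := (@lebesgue_measure R).

Lemma fro2_sq_integrable p q (F : R -> 'M[R]_(p, q)) (C : R) : meas_mx F ->
  (\int[mu]_(t in @I01 R) (fro2 (F t))%:E <= C%:E)%E -> mx_sq_integrable01 F.
Proof.
move=> mF FC i j; split; first exact: mF.
apply/integrableP; split; first by apply/measurable_EFinP; apply: meas01X; exact: mF.
apply: le_lt_trans (ltry C); apply: le_trans FC; apply: ge0_le_integral.
- exact: measurable_I01.
- by [].
- apply: measurableT_comp => //; apply/measurable_EFinP; apply: meas01X; exact: mF.
- by apply/measurable_EFinP; exact: meas_mx_fro2.
- move=> t _; rewrite gee0_abs ?lee_fin ?sqr_ge0//.
  by rewrite /fro2 (bigD1 (i, j))//= lerDl sumr_ge0// => k _; rewrite sqr_ge0.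
Qed.

Lemma cont_mx_nrm1_bounded p q (F : R -> 'M[R]_(p, q)) : cont_mx F ->
  exists2 B : R, 0 <= B & forall t, 0 <= t <= 1 -> nrm1 (F t) <= B.
Proof.
move=> cF; have [|B B0 HB] := @cont01_bounded R (fun t => nrm1 (F t)).
  apply: cont01_sum => k t.
  have H := cF k.1 k.2 t.
  exact: cvg_norm H.
by exists B => // t /HB; apply: le_trans; exact: ler_norm.
Qed.

Lemma fro2_affine_bound p q p' q' (F : R -> 'M[R]_(p, q)) (G : R -> 'M[R]_(p', q')) (a b C : R) :
  meas_mx F -> meas_mx G -> 0 <= a -> 0 <= b ->
  (forall t, 0 <= t <= 1 -> fro2 (G t) <= a * fro2 (F t) + b) ->
  (\int[mu]_(t in @I01 R) (fro2 (F t))%:E <= C%:E)%E ->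
  (\int[mu]_(t in @I01 R) (fro2 (G t))%:E <= (a * C + b)%:E)%E.
Proof.
move=> mF mG a0 b0 le_ab FC.
have m2 : meas01 (fun t => fro2 (F t)) by exact: meas_mx_fro2.
apply: (@le_trans _ _ (\int[mu]_(t in @I01 R) (a%:E * (fro2 (F t))%:E + b%:E))%E).
  apply: ge0_le_integral.
  - exact: measurable_I01.
  - by move=> t _; rewrite lee_fin fro2_ge0.
  - by apply/measurable_EFinP; exact: meas_mx_fro2.
  - apply/measurable_EFinP; apply: (@meas01D _ (fun t => a * fro2 (F t)) (fun=> b)); last exact: meas01_cst.
    by apply: meas01M => //; exact: meas01_cst.
  - by move=> t; rewrite /I01/= in_itv/= -EFinM -EFinD lee_fin => /le_ab.
rewrite ge0_integralD//=; first last.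
- apply/measurable_EFinP; apply: (@meas01M _ (fun=> a)) m2; exact: meas01_cst.
- by move=> t _; rewrite lee_fin mulr_ge0 ?fro2_ge0.
- exact: measurable_I01.
rewrite EFinD; apply: leeD.
  rewrite ge0_integralZl_EFin//=; first last.
  - exact/measurable_EFinP.
  - by move=> t _; rewrite lee_fin fro2_ge0.
  - exact: measurable_I01.
  by rewrite EFinM lee_wpmul2l.
rewrite integral_cst; last exact: measurable_I01.
by rewrite -[leRHS]mule1; apply: lee_wpmul2l => //; rewrite -lebesgue_measure_I01.
Qed.

End square_integrability.

Section existence.
Variables (R : realType) (n m : nat) (S0 S1 : 'M[R]_n) (eps : R).
Variables (Y Yd : R -> 'M[R]_(n, m)) (N : R -> 'M[R]_(n - m, n)).
Hypotheses (mn : (m < n)%N) (pS0 : SymPos S0) (eps0 : 0 < eps) (C1Y : mx_C1_on01 Y Yd).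
Hypothesis rY : forall t, 0 <= t <= 1 -> \rank (Y t) = m.
Hypothesis NY0 : N 0 *m Y 0 = 0.
Hypothesis rN : \rank (row_mx (Y 0) (N 0)^T) = n.
Hypothesis dN : mx_deriv_on01 N (fun t => - (N t *m Mcurve Y Yd t)).
Local Notation mu := (@lebesgue_measure R).
Local Notation W := (cost_form S0 eps).
Local Notation adm := (admissible2' eps S0 S1 Y Yd N).

Lemma admissible_cost_fin K Phi : adm K Phi -> exists x, [/\ 0 <= x,
  cost2' eps S0 K Phi = x%:E &
  (\int[mu]_(t in @I01 R) (qf (W (Phi t)) (K t *m Phi t))%:E = (2 * x)%:E)%E].
Proof.
move=> a; have mK := admissible_meas a.
have cP : cont_mx Phi by exact: admissible_cont a.
have uP := admissible_unit a.
have E := cost2'E pS0 eps0 mK (cont_mx_meas cP) uP.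
have : (cost2' eps S0 K Phi < +oo)%E by case: a => _ [_ [_ [_ [_ [_ [_ []]]]]]].
rewrite E; set J := (X in (_ * X)%E).
have J0 : (0 <= J)%E.
  by apply: integral_ge0 => t _; rewrite lee_fin; exact: qf_cost_form_ge0.
move: J0; case JE : J => [r||] //; last by rewrite gt0_muley// lte_fin invr_gt0.
rewrite lee_fin => r0 _; exists (r / 2); split; first by rewrite divr_ge0.
  by rewrite -EFinM mulrC.
by apply: etrans JE _; congr EFin; field.
Qed.

(** The identity $\Phi_sY_0=Y_s$ is differentiated at an interior point through forward difference
    quotients and uniqueness of limits. *)
Lemma limit_constraint (Phis D : R -> 'M[R]_n) t :
  (forall s, 0 <= s <= 1 -> Phis s *m Y 0 = Y s) -> 0 < t < 1 ->
  (forall i j, derivable (fun s => Phis s i j) t 1) ->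
  (forall i j, D t i j = derive1 (fun s => Phis s i j) t) -> D t *m Y 0 = Yd t.
Proof.
move=> PY /andP[t0 t1] dP DE.
have ab (k : nat) : t <= t <= t + k.+1%:R^-1 by rewrite lexx/= lerDl invr_ge0.
have len (k : nat) : t + k.+1%:R^-1 - t = k.+1%:R^-1 by rewrite addrAC subrr add0r.
have c1 : cvg_mx \oo (fun k => k.+1%:R *: (Phis (t + k.+1%:R^-1) - Phis t) *m Y 0) (D t *m Y 0).
  apply: cvg_mxM; last exact: cvg_mx_cst.
  move=> i j; rewrite DE; have := straddle_cvg (dP i j) ab len.
  by under [in X in _ -> X]eq_fun do rewrite !mxE.
apply: cvg_mx_unique c1 _ => i j.
have dY := deriv_on01_is_derive (C1Y.1 i j) (_ : 0 < t < 1).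
have [|dYt dYE] := dY; first by rewrite t0 t1.
have := straddle_cvg dYt ab len; rewrite derive1E dYE.
apply: cvg_trans; apply: near_eq_cvg.
(* The identity is known only up to time 1, so the quotients agree once the step $1/(k+1)$ is below
   $1-t$. *)
have t10 : 0 < 1 - t by rewrite subr_gt0.
have [J _ HJ] := near_infty_natSinv_lt (PosNum t10).
exists J => // k /= Jk; have := HJ _ Jk; rewrite /= => kt.
rewrite -scalemxAl mulmxBl !PY ?mxE//; first by rewrite !(ltW t0) ltW.
have := ab k => /andP[_ h]; rewrite (le_trans (ltW t0) h)/=.
by rewrite ltrBrDl in kt; exact: ltW.
Qed.

Lemma minimizer_exists : (exists K Phi, adm K Phi) ->
  exists Ks Phis, adm Ks Phis /\
    forall K Phi, adm K Phi -> (cost2' eps S0 Ks Phis <= cost2' eps S0 K Phi)%E.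
Proof.
move=> [K0 [Phi0 adm0]].
pose E := [set x : R | exists K Phi, adm K Phi /\ cost2' eps S0 K Phi = x%:E].
have Elb : lbound E 0.
  move=> x [K [Phi [/admissible_cost_fin[y [y0 -> _]] [<-]]]]; exact: y0.
have hE : has_inf E.
  split; last by exists 0.
  by have [x [_ xE _]] := admissible_cost_fin adm0; exists x, K0, Phi0.
pose c := inf E.
have c0 : 0 <= c by apply: lb_le_inf => //; exact: hE.1.
have /choice[KP HKP] : forall k : nat, exists p : (R -> 'M[R]_n) * (R -> 'M[R]_n),
    adm p.1 p.2 /\ exists2 x, cost2' eps S0 p.1 p.2 = x%:E & x < c + k.+1%:R^-1.
  move=> k; have k0 : 0 < k.+1%:R^-1 :> R by rewrite invr_gt0.
  have [x [K [Phi [a aE]]] xc] := inf_adherent k0 hE.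
  by exists (K, Phi); split => //; exists x.
pose K k := (KP k).1; pose Phi k := (KP k).2.
have a k : adm (K k) (Phi k) by case: (HKP k).
have costk k : (\int[mu]_(t in @I01 R) (qf (W (Phi k t)) (K k t *m Phi k t))%:E <=
    (2 * c + 2 * k.+1%:R^-1)%:E)%E.
  have [x [_ xE ->]] := admissible_cost_fin (a k).
  have [_ [y yE yc]] := HKP k; rewrite lee_fin -mulrDr ler_pM2l//.
  by move: xE; rewrite /K /Phi yE => -[<-]; exact: ltW.
have mK k := admissible_meas (a k).
have cP k : cont_mx (Phi k) by exact: admissible_cont (a k).
have uP k := admissible_unit (a k).
have iP k := admissible_init (a k).
have pP k := admissible_prim (a k).
(* The integral of the density is twice the cost, hence at most $2c+2/(k+1)\le2c+2$ along the
   sequence; coercivity divides this by [eps]. *)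
pose C := (2 * c + 2) / eps.
have C0 : 0 <= C by rewrite divr_ge0 ?(ltW eps0)// addr_ge0// mulr_ge0.
have eK k : (\int[mu]_(t in @I01 R) (fro2 (K k t))%:E <= C%:E)%E.
  have cPk : cont_mx (Phi k) by exact: cP.
  have := energy_le pS0 eps0 (mK k) (cont_mx_meas cPk) (uP k); apply.
  apply: le_trans (costk k) _; rewrite lee_fin lerD2l -[leRHS]mulr1 ler_pM2l//.
  by rewrite invf_le1// ler1n.
have PY k := admissible_mulY (a k) C1Y rY NY0 dN C0 (eK k).
have [Phis [U [UU Utail] [clampP uPs cvP cvV]]] := flow_limit C0 mK uP iP pP eK.
have c20 : 0 <= 2 * c by rewrite mulr_ge0.
have costK e : 0 < e -> exists k0, forall k, (k0 <= k)%N ->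
    (\int[mu]_(t in @I01 R) (qf (W (Phi k t)) (K k t *m Phi k t))%:E <= (2 * c + e)%:E)%E.
  move=> e0; have e20 : 0 < e / 2 by rewrite divr_gt0.
  have [k0 _ Hk0] := near_infty_natSinv_lt (PosNum e20).
  exists k0 => k kk0; apply: le_trans (costk k) _; rewrite lee_fin lerD2l.
  by have := Hk0 _ kk0; rewrite /= ltr_pdivlMr// mulrC => /ltW.
have acP : mx_abs_cont_on01 Phis := limit_abs_cont (UU := UU) C0 mK uP iP pP eK cvP.
have cPs : cont_mx Phis by move=> i j; apply: abs_cont_cont01; exact: acP.
pose D := limit_deriv Phis.
have mD : meas_mx D := limit_deriv_meas (UU := UU) C0 mK uP iP pP eK clampP cvP.
(* The optimal generator is defined from the limit flow. As [D] agrees with the derivative wherever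
   that exists, the flow equation holds at every interior point of differentiability. *)
pose Ks t := D t *m invmx (Phis t).
have KsP t : 0 <= t <= 1 -> Ks t *m Phis t = D t by move=> /uPs u; rewrite /Ks mulmxKV.
have cVs : cont_mx (fun t => invmx (Phis t)) by exact: cont_mx_inv.
have mKs : meas_mx Ks by apply: meas_mxM => //; exact: cont_mx_meas.
have le_c : (\int[mu]_(t in @I01 R) (qf (W (Phis t)) (Ks t *m Phis t))%:E <= (2 * c)%:E)%E.
  apply: le_trans (limit_cost_le (UU := UU) pS0 eps0 C0 c20 mK cP uP iP pP eK costK Utail clampP uPs cvP cvV).
  rewrite le_eqVlt; apply/orP; left; apply/eqP; apply: eq_integral => t.
  by rewrite inE /I01/= in_itv/= => /KsP ->.
have eKs := energy_le pS0 eps0 mKs (cont_mx_meas cPs) uPs le_c.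
have cost_le : (cost2' eps S0 Ks Phis <= c%:E)%E.
  rewrite (cost2'E pS0 eps0 mKs (cont_mx_meas cPs) uPs).
  apply: le_trans (lee_wpmul2l _ le_c) _; first by rewrite lee_fin invr_ge0.
  by rewrite -EFinM lee_fin mulKf.
have PYs t : 0 <= t <= 1 -> Phis t *m Y 0 = Y t.
  move=> t01; apply: (@cvg_mx_unique _ _ U _ _ _ (fun k => Phi k t *m Y 0)).
    by apply: cvg_mxM; [exact: cvP|exact: cvg_mx_cst].
  rewrite (_ : (fun k => _) = fun=> Y t); first exact: cvg_mx_cst.
  by apply/funext => k; exact: PY.
have z01 : 0 <= (0 : R) <= 1 by rewrite lexx ler01.
have o01 : 0 <= (1 : R) <= 1 by rewrite lexx ler01.
have dPs t : 0 < t < 1 -> (forall i j, derivable (fun s => Phis s i j) t 1) ->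
    forall i j, D t i j = derive1 (fun s => Phis s i j) t.
  by move=> t01 dP i j; rewrite mxE upper_derivE.
exists Ks, Phis; split; last first.
  move=> K' Phi' a'; have [x [_ xE _]] := admissible_cost_fin a'.
  apply: (le_trans cost_le); rewrite xE lee_fin; apply: ge_inf; first by exists 0.
  by exists K', Phi'.
split; first exact: fro2_sq_integrable mKs eKs.
split => //; split => //; split.
  apply: (@cvg_mx_unique _ _ U _ _ _ (fun k => Phi k 0)); first exact: cvP.
  by rewrite (_ : (fun k => _) = fun=> 1%:M); [exact: cvg_mx_cst|apply/funext => k; exact: iP].
split.
  move=> t t01 dP i j; have t01' : 0 <= t <= 1 by case/andP: t01 => /ltW -> /ltW ->.
  by rewrite KsP// dPs.
split.
  apply: (@cvg_mx_unique _ _ U _ _ _ (fun k => Phi k 1 *m S0 *m (Phi k 1)^T)).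
    apply: cvg_mxM; last by apply: cvg_mx_tr; exact: cvP.
    by apply: cvg_mxM; [exact: cvP|exact: cvg_mx_cst].
  rewrite (_ : (fun k => _) = fun=> S1); first exact: cvg_mx_cst.
  by apply/funext => k; case: (a k) => _ [_ [_ [_ [_ []]]]].
split; first by rewrite PYs.
split; last by apply: le_lt_trans cost_le (ltry _).
(* A continuous right inverse of $N_t$. Multiplying $K-M$ by it gives the coefficient curve, and
   continuity of [G] transfers square integrability from $K$. *)
pose G t := (N t)^T *m invmx (N t *m (N t)^T).
have cN : cont_mx N by exact: cont_N dN.
have cNt := cont_mx_tr cN.
have fN t : 0 <= t <= 1 -> row_free (N t) := N_row_free C1Y rY dN mn rN (t := t).
have uN t : 0 <= t <= 1 -> N t *m (N t)^T \in unitmx.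
  by move=> /fN/eqP r; have := @gram_unitmx _ _ _ (N t)^T; rewrite trmxK mxrank_tr; exact.
have cG : cont_mx G by apply: cont_mxM => //; apply: cont_mx_inv => //; exact: cont_mxM.
have cM : cont_mx (Mcurve Y Yd) := cont_Mcurve C1Y rY.
pose Rc t := (Ks t - Mcurve Y Yd t) *m G t.
have mRc : meas_mx Rc.
  apply: meas_mxM; last exact: cont_mx_meas.
  by apply: meas_mxB => //; exact: cont_mx_meas.
exists Rc; split; last first.
  have : {ae mu, forall t, forall p : 'I_n * 'I_n, 0 < t < 1 ->
      derivable (fun s => Phis s p.1 p.2) t 1}.
    apply: ae_forall_fin => p; have [g Hg] := abs_cont_prim (acP p.1 p.2).
    by apply: aeS (prim_derivable_ae Hg) => t H /H[].
  move=> dae; apply: aeS (aeI dae (ae_interior R)) => t [dt It] It01.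
  have t01 := It It01; have t01' : 0 <= t <= 1 by case/andP: t01 => /ltW -> /ltW ->.
  have dP i j : derivable (fun s => Phis s i j) t 1 by exact: dt (i, j) t01.
  have DY := limit_constraint PYs t01 dP (dPs t t01 dP).
  have KY : (Ks t - Mcurve Y Yd t) *m Y t = 0.
    rewrite mulmxBl (Mcurve_mulY _ rY t01') -(PYs t t01') mulmxA KsP// DY.
    by rewrite subrr.
  have := annihilator_factor (ltnW mn) (rY t01') (fN t t01') (N_mulY C1Y rY NY0 dN t01') KY.
  by rewrite /Rc /G !mulmxA => <-; rewrite addrC subrK.
have [g g0 Hg] := cont_mx_nrm1_bounded cG.
have [b b0 Hb] : exists2 b : R, 0 <= b & forall t, 0 <= t <= 1 -> fro2 (Mcurve Y Yd t) <= b.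
  have cf : cont01 (fun t => fro2 (Mcurve Y Yd t)).
    apply: cont01_sum => k.
    by apply: (@cont01M _ (fun t => Mcurve Y Yd t k.1 k.2) (fun t => Mcurve Y Yd t k.1 k.2)); exact: cM.
  by have [b b0 Hb] := cont01_bounded cf; exists b => // t /Hb; apply: le_trans; exact: ler_norm.
(* The bound is $|R_t|^2\le h|K_t-M_t|^2\le h(2|K_t|^2+2b)$ in squared Frobenius norms, with the
   energy of $K$ at most $2c/\varepsilon$. *)
pose h := g ^+ 2 * (n%:R * (n - m)%:R).
have h0 : 0 <= h by rewrite mulr_ge0 ?sqr_ge0// mulr_ge0.
apply: (@fro2_sq_integrable _ _ _ Rc (h * 2 * (2 * c / eps) + h * (2 * b))) => //.
apply: fro2_affine_bound mKs mRc _ _ _ eKs; [by rewrite mulr_ge0|by rewrite !mulr_ge0|].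
move=> t t01; apply: le_trans (fro2M_le _ (Hg t t01)) _; rewrite -/h -mulrA -mulrDr ler_wpM2l//.
apply: le_trans (fro2B_le _ _) _; rewrite lerD2l ler_pM2l//; exact: Hb.
Qed.

End existence.

Theorem theorem2 (R : realType) (n m : nat) (S0 S1 : 'M[R]_n) (eps : R)
  (Y Yd : R -> 'M[R]_(n, m)) (N0 : 'M[R]_(n - m, n)) (N : R -> 'M[R]_(n - m, n)) :
  (2 <= n)%N -> (1 <= m)%N -> (m < n)%N ->
  SymPos S0 -> SymPos S1 -> 0 < eps ->
  mx_C1_on01 Y Yd ->
  (forall t : R, 0 <= t <= 1 -> \rank (Y t) = m) ->
  N0 *m Y 0 = 0 ->
  \rank (row_mx (Y 0) N0^T) = n ->
  N 0 = N0 ->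
  mx_deriv_on01 N (fun t => - (N t *m Mcurve Y Yd t)) ->
  (exists K Phi, admissible2' eps S0 S1 Y Yd N K Phi) ->
  exists Ks Phis, admissible2' eps S0 S1 Y Yd N Ks Phis /\
    forall K Phi, admissible2' eps S0 S1 Y Yd N K Phi ->
      (cost2' eps S0 Ks Phis <= cost2' eps S0 K Phi)%E.
Proof.
move=> _ _ mn pS0 _ eps0 C1Y rY NY0 rN N00 dN; rewrite -N00 in NY0 rN.
exact: minimizer_exists.
Qed.
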